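(* Let $\varphi$ be a $\mathcal{C}^2$ strictly convex function on $\mathbb{R}^n$ such that $\lim_{\|x\|\to\infty}\varphi(x)/\|x\|=\infty$ and $\int e^{-\varphi(x)}dx=1$, and let $\mu_\varphi$ be the probability measure $d\mu_\varphi(x)=e^{-\varphi(x)}dx$ on $\mathbb{R}^n$. Then for every smooth enough function $g$ on $\mathbb{R}^n$, $$\mathbf{Var}_{\mu_\varphi}(g)\leq \int \nabla g\cdot \mathrm{Hess}(\varphi)^{-1}\nabla g\,d\mu_\varphi,$$ where $\mathrm{Hess}(\varphi)^{-1}$ denotes the inverse of the Hessian of $\varphi$.
   Context: $\|\cdot\|$ is the Euclidean norm on $\mathbb{R}^n$, $\cdot$ the Euclidean scalar product, and $dx$ Lebesgue measure. For a probability measure $\mu$, $\mathbf{Var}_\mu(g)=\int\big(g-\int g\,d\mu\big)^2d\mu$. ''Smooth enough'' is meant to include that the integrals involved exist. *)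

(* Defs.v *)
From HB Require Import structures.
From mathcomp Require Import all_boot all_order all_algebra.
From mathcomp Require Import all_classical all_reals all_analysis.

Set Implicit Arguments.
Unset Strict Implicit.
Unset Printing Implicit Defensive.

Import Order.TTheory GRing.Theory Num.Theory.
Import numFieldNormedType.Exports.

Local Open Scope classical_set_scope.
Local Open Scope ring_scope.

(** The product sigma-algebra on row vectors, generated by the coordinates
    (for [T] the real line with its Borel sets, this is the Borel
    sigma-algebra of R^n). *)

Definition measure_rV_display : measure_display -> measure_display.
Proof. exact. Qed.

Section measurable_rV.
Context {d} {T : measurableType d}.
Variable n : nat.

Let coors : 'I_n -> 'rV[T]_n -> T := fun i x => x ord0 i.

Let rV_set0 : g_sigma_preimage coors set0.
Proof. exact: sigma_algebra0. Qed.

Let rV_setC A : g_sigma_preimage coors A -> g_sigma_preimage coors (~` A).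
Proof. exact: sigma_algebraC. Qed.

Let rV_bigcup (F : _^nat) : (forall i, g_sigma_preimage coors (F i)) ->
  g_sigma_preimage coors (\bigcup_i (F i)).
Proof. exact: sigma_algebra_bigcup. Qed.

HB.instance Definition _ := @isMeasurable.Build (measure_rV_display d)
  'rV[T]_n (g_sigma_preimage coors) rV_set0 rV_setC rV_bigcup.

End measurable_rV.

Lemma measurable_rV_coord d (T : measurableType d) n (i : 'I_n) :
  measurable_fun [set: 'rV[T]_n] (fun x : 'rV[T]_n => x ord0 i).
Proof.
move=> _ Y mY; rewrite setTI; apply: sub_sigma_algebra => /=.
rewrite -bigcup_seq/=; exists i => /=; first by rewrite mem_index_enum.
by exists Y => //; rewrite setTI.
Qed.

Lemma measurable_fun_rVP d1 d2 (T1 : measurableType d1) (T2 : measurableType d2)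
    n (f : T1 -> 'rV[T2]_n) :
  (forall i, measurable_fun [set: T1] (fun x => f x ord0 i)) ->
  measurable_fun [set: T1] f.
Proof.
move=> mf.
have prefS : g_sigma_preimage (fun i x => f x ord0 i) `<=` measurable.
  apply: smallest_sub; first exact: sigma_algebra_measurable.
  case: n => [|n] in f mf *; first by rewrite big_ord0.
  rewrite -bigcup_mkord_ord; apply: bigcup_sub => i Ii.
  by move=> A [B mB <-]; exact: mf.
move=> _ A mA; apply: prefS.
have -> : (fun i x => f x ord0 i) =
  (fun i => (fun x : 'rV[T2]_n => x ord0 i) \o f) by [].
by rewrite g_sigma_preimage_comp; exists A.
Qed.

Definition consrV (T : Type) n (p : T * 'rV[T]_n) : 'rV[T]_n.+1 :=
  \row_i if unlift ord0 i is Some j then p.2 ord0 j else p.1.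

Lemma measurable_consrV d (T : measurableType d) n :
  measurable_fun [set: T * 'rV[T]_n] (@consrV T n).
Proof.
apply: measurable_fun_rVP => i.
case: (unliftP ord0 i) => [j|] ij.
- rewrite (_ : (fun _ => _) = (fun x : 'rV[T]_n => x ord0 j) \o snd).
    by apply: measurableT_comp => //; exact: measurable_rV_coord.
  by apply/funext => -[a v]; rewrite mxE ij liftK.
- rewrite (_ : (fun _ => _) = fst) //.
  by apply/funext => -[a v]; rewrite mxE ij unlift_none.
Qed.

Section lebesgue_rV_step.
Local Open Scope ereal_scope.
Context {R : realType}.
Variables (n : nat) (m : {sigma_finite_measure set 'rV[R]_n -> \bar R}).

Let mcons :
  measurable_fun [set: measurableTypeR R * 'rV[R]_n] (@consrV R n).
Proof. exact: (@measurable_consrV _ R n). Qed.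

Let P : {measure set (measurableTypeR R * 'rV[R]_n)%type -> \bar R} :=
  @lebesgue_measure R \x m.

Definition lebesgue_rV_step : set 'rV[R]_n.+1 -> \bar R :=
  pushforward (@lebesgue_measure R \x m) (@consrV R n).

Let step0 : lebesgue_rV_step set0 = 0.
Proof. by rewrite /lebesgue_rV_step /pushforward preimage_set0 (measure0 P). Qed.

Let step_ge0 A : 0 <= lebesgue_rV_step A.
Proof. exact: (measure_ge0 P). Qed.

Let step_sigma_additive : semi_sigma_additive lebesgue_rV_step.
Proof.
exact: (@measure_semi_sigma_additive _ _ _
  (measure_function_pushforward__canonical__measure_function_Measure P mcons)).
Qed.

HB.instance Definition _ := isMeasure.Build _ _ _ lebesgue_rV_step
  step0 step_ge0 step_sigma_additive.

Let step_sigma_finite : sigma_finite setT lebesgue_rV_step.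
Proof.
have [F UF mF] : sigma_finite setT P.
  have /sigma_finiteP[F [TF ndF Foo]] := sigma_finiteT (@lebesgue_measure R).
  have /sigma_finiteP[G [TG ndG Goo]] := sigma_finiteT m.
  exists (fun k => F k `*` G k).
    apply/esym; rewrite -subTset => -[x y] _.
    have [k _ Fk] : (\bigcup_k F k) x by rewrite -TF.
    have [l _ Gl] : (\bigcup_k G k) y by rewrite -TG.
    exists (maxn k l) => //; split => /=.
    - by move: x Fk; exact/subsetPset/ndF/leq_maxl.
    - by move: y Gl; exact/subsetPset/ndG/leq_maxr.
  move=> k; have [? ?] := Foo k; have [? ?] := Goo k.
  split; first exact: measurableX.
  by rewrite /P /= product_measure1E// lte_mul_pinfty// ge0_fin_numE.
pose tlrV (x : 'rV[R]_n.+1) : measurableTypeR R * 'rV[R]_n :=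
  (x ord0 ord0, \row_j x ord0 (lift ord0 j)).
have mtl : measurable_fun [set: 'rV[R]_n.+1] tlrV.
  apply: measurable_fun_pair; first exact: (@measurable_rV_coord _ R).
  apply: measurable_fun_rVP => i.
  rewrite (_ : (fun _ => _) = fun x : 'rV[R]_n.+1 => x ord0 (lift ord0 i)).
    exact: measurable_rV_coord.
  by apply/funext => x; rewrite mxE.
exists (fun i => tlrV @^-1` F i).
  by rewrite -preimage_bigcup -UF preimage_setT.
move=> i; have [mFi Fi] := mF i; split.
  by rewrite -[X in measurable X]setTI; exact: mtl.
rewrite /lebesgue_rV_step /pushforward -comp_preimage.
rewrite (_ : tlrV \o _ = idfun) ?preimage_id//.
apply/funext => -[a v]; rewrite /tlrV /consrV /= mxE unlift_none; congr pair.
by apply/rowP => j; rewrite !mxE liftK.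
Qed.

HB.instance Definition _ := Measure_isSigmaFinite.Build _ _ _ lebesgue_rV_step
  step_sigma_finite.

End lebesgue_rV_step.

Fixpoint lebesgue_rV (R : realType) (n : nat) :
    {sigma_finite_measure set 'rV[R]_n -> \bar R} :=
  match n with
  | 0 => \d_(0 : 'rV[R]_0)
  | n'.+1 => lebesgue_rV_step (lebesgue_rV R n')
  end.

Lemma measurable_box_rV (R : realType) n (A : 'I_n -> set R) :
  (forall i, measurable (A i)) ->
  measurable [set x : 'rV[R]_n | forall i, A i (x ord0 i)].
Proof.
move=> mA.
have -> : [set x : 'rV[R]_n | forall i, A i (x ord0 i)] =
    \big[setI/setT]_(i < n) ((fun x : 'rV[R]_n => x ord0 i) @^-1` (A i)).
  apply/seteqP; split => x /=.
    by move=> H; rewrite -bigcap_seq/= => i _; exact: H.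
  by rewrite -bigcap_seq/= => H i; apply: H; exact: mem_index_enum.
apply: bigsetI_measurable => i _; rewrite -[X in measurable X]setTI.
exact: measurable_rV_coord.
Qed.

Lemma lebesgue_rV_box (R : realType) n (A : 'I_n -> set R) :
  (forall i, measurable (A i)) ->
  (lebesgue_rV R n [set x | forall i, A i (x ord0 i)] =
   \prod_i lebesgue_measure (A i))%E.
Proof.
elim: n A => [|n IH] A mA.
  by rewrite big_ord0 /= diracE mem_set// => -[].
rewrite big_ord_recl -IH /=; last by move=> i; exact: mA.
rewrite /lebesgue_rV_step /pushforward -product_measure1E//=.
- congr (_ _); apply/seteqP; split => -[a v] /=.
    move=> H; split; first by have := H ord0; rewrite mxE unlift_none.
    by move=> i; have := H (lift ord0 i); rewrite mxE liftK.
  by move=> [H1 H2] i; rewrite mxE; case: unliftP => [j ->|->].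
- exact: mA.
- by apply: (@measurable_box_rV R n (fun i => A (lift ord0 i))) => i; exact: mA.
Qed.

Section calculus.
Context {R : realType} {n : nat}.
Implicit Types (f : 'rV[R]_n -> R) (x y : 'rV[R]_n) (i j : 'I_n).

Definition dotp x y : R := \sum_i x ord0 i * y ord0 i.

(* The norm [`|x|] provided by the library on row vectors is the sup norm. *)
Definition enorm x : R := Num.sqrt (dotp x x).

Definition enorm_pinfty : set_system 'rV[R]_n :=
  filter_from setT (fun r : R => [set x | r < enorm x]).

Definition partial i f x : R := 'D_(delta_mx ord0 i) f x.

Definition grad f x : 'rV[R]_n := \row_i partial i f x.

Definition hess f x : 'M[R]_n := \matrix_(i, j) partial i (partial j f) x.

Definition C1 f :=
  (forall x, differentiable f x) /\ (forall i, continuous (partial i f)).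

Definition C2 f :=
  (forall x, differentiable f x) /\ (forall i, C1 (partial i f)).

Definition strictly_convex f := forall x y (t : R),
  x != y -> 0 < t < 1 ->
  f (t *: x + (1 - t) *: y) < t * f x + (1 - t) * f y.

(* [invmx A] is [A] itself when [A] is singular. A strictly convex function may
   have a singular Hessian at some points, where the inverse does not exist:
   the quadratic form is given the value [+oo] there. *)
Definition inv_quad (A : 'M[R]_n) x : \bar R :=
  if A \in unitmx then (dotp x (x *m invmx A))%:E else +oo%E.

End calculus.

(* Main.v *)
Require Import Defs.
From HB Require Import structures.
From mathcomp Require Import all_boot all_order all_algebra.
From mathcomp Require Import all_classical all_reals all_analysis.
From mathcomp Require Import measurable_realfun.
From mathcomp Require Import ring lra.

Set Implicit Arguments.
Unset Strict Implicit.
Unset Printing Implicit Defensive.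

Import Order.TTheory GRing.Theory Num.Theory.
Import numFieldNormedType.Exports.

Local Open Scope classical_set_scope.
Local Open Scope ring_scope.

(** The inequality is proved on cubes by induction on the dimension, and the
    general case follows by exhausting the space with cubes.

    Call a continuous function [q] admissible for [phi] and [g] if it is at
    least [2 w . grad g - w . Hess(phi) w] at every point and for all vectors
    [w].  When the Hessian is positive definite, the least such [q] is
    [grad g . Hess(phi)^-1 grad g], by duality of quadratic forms.  The lemma
    [brascamp_lieb_cube] bounds the variance of [g] for the measure with density
    proportional to [exp (- phi)] on a cube by the mean of any admissible [q].

    In dimension one ([poincare_1d]) this is a consequence of the
    Cauchy-Schwarz inequality.  For the inductive step, condition on the first
    coordinate [x].  The variance of [g] is the mean of its conditional variance
    plus the variance of its conditional mean [G x].  The marginal of the first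
    coordinate has a potential [V], and differentiating under the integral sign
    expresses [G'] and [V''] by conditional means and covariances of partial
    derivatives of [phi] and [g].  Restricting the admissibility of [q] to
    vectors [w] of first coordinate [t] makes the induction hypothesis
    applicable to [g - t * (d phi / dx)] on each fiber, for all [t]; together
    these inequalities say that the conditional mean of [q] minus the
    conditional variance of [g] is admissible for [V] and [G].  The
    one-dimensional inequality for the marginal then finishes the step.

    For [phi] of class C^2 and convex, the Hessian is symmetric and positive
    semidefinite ([hess_sym], [hess_psd]).  Since it may be singular, [phi] is
    replaced by [phi + e |x|^2 / 2], whose inverse Hessian is continuous and
    gives a smaller quadratic form ([ridge_quad_le]).  Letting the cube grow
    while [e] tends to [0] yields the theorem for centered functions
    ([centered_brascamp_lieb]), and subtracting its mean from [g] changes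
    neither side. *)

(** * Continuous real functions *)

Lemma continuous_mul (R : realType) (T : topologicalType) (f g : T -> R) :
  continuous f -> continuous g -> continuous (fun x => f x * g x).
Proof. by move=> cf cg x; exact: (cvgM (cf x) (cg x)). Qed.

Lemma continuous_add (R : realType) (T : topologicalType) (f g : T -> R) :
  continuous f -> continuous g -> continuous (fun x => f x + g x).
Proof. by move=> cf cg x; exact: (cvgD (cf x) (cg x)). Qed.

Lemma continuous_sub (R : realType) (T : topologicalType) (f g : T -> R) :
  continuous f -> continuous g -> continuous (fun x => f x - g x).
Proof. by move=> cf cg x; exact: (cvgB (cf x) (cg x)). Qed.

Lemma continuous_scale (R : realType) (T : topologicalType) (c : R) (f : T -> R) :
  continuous f -> continuous (fun x => c * f x).
Proof. by move=> cf; apply: continuous_mul => //; exact: cst_continuous. Qed.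

Lemma continuous_expRN (R : realType) (T : topologicalType) (f : T -> R) :
  continuous f -> continuous (fun x => expR (- f x)).
Proof.
move=> cf x.
exact: (continuous_comp (continuousN (cf x)) (@continuous_expR R _)).
Qed.

Lemma continuous_sumr (R : realType) (T : topologicalType) I (r : seq I)
    (f : I -> T -> R) : (forall i, continuous (f i)) ->
  continuous (fun x => \sum_(i <- r) f i x).
Proof.
move=> cf; elim: r => [|i r IH].
  by under eq_fun do rewrite big_nil; exact: cst_continuous.
by under eq_fun do rewrite big_cons; exact: continuous_add.
Qed.

Lemma continuous_prodr (R : realType) (T : topologicalType) I (r : seq I)
    (f : I -> T -> R) : (forall i, continuous (f i)) ->
  continuous (fun x => \prod_(i <- r) f i x).
Proof.
move=> cf; elim: r => [|i r IH].
  by under eq_fun do rewrite big_nil; exact: cst_continuous.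
by under eq_fun do rewrite big_cons; exact: continuous_mul.
Qed.

Lemma continuous_bounded_on (R : realType) (T : topologicalType) (f : T -> R) A :
  compact A -> continuous f -> exists C : R, forall x, A x -> `|f x| <= C.
Proof.
move=> cA cf.
have /compact_bounded[C [_ CP]] : compact (f @` A).
  by apply: continuous_compact => //; exact: continuous_subspaceT.
exists (C + 1) => x Ax; apply: (CP (C + 1)); first by rewrite ltrDl.
by exists x.
Qed.

(** * A weighted Poincare inequality on an interval *)

Lemma ge0_derive_le (R : realType) (f df : R -> R) (a b : R) :
  (forall x, a <= x <= b -> is_derive x 1 f (df x)) ->
  (forall x, a <= x <= b -> 0 <= df x) ->
  forall x, a <= x <= b -> f a <= f x.
Proof.
move=> fdf df0 x /andP[ax xb].
have fdf' y : y \in `]a, x[ -> is_derive y 1 f (df y).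
  rewrite in_itv/= => /andP[ay yx]; apply: fdf.
  by rewrite (ltW ay) (le_trans (ltW yx)).
have cf : {within `[a, x], continuous f}.
  apply: derivable_within_continuous => y; rewrite in_itv/= => /andP[ay yx].
  by have [] := fdf y; rewrite ?ay ?(le_trans yx).
have [c] := MVT_segment ax fdf' cf.
rewrite in_itv/= => /andP[ac cx] e; rewrite -subr_ge0 e mulr_ge0 ?subr_ge0//.
by apply: df0; rewrite ac (le_trans cx).
Qed.

Lemma le_derive_le (R : realType) (f g df dg : R -> R) (a b : R) : f a = g a ->
  (forall x, a <= x <= b -> is_derive x 1 f (df x)) ->
  (forall x, a <= x <= b -> is_derive x 1 g (dg x)) ->
  (forall x, a <= x <= b -> df x <= dg x) ->
  forall x, a <= x <= b -> f x <= g x.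
Proof.
move=> fga fdf gdg dfg x xab.
rewrite -subr_ge0; have <- : (g - f) a = 0 by rewrite !fctE fga subrr.
apply: (@ge0_derive_le _ (g - f) (fun x => dg x - df x) a b) => // y yab.
  by have := fdf _ yab; have := gdg _ yab => ? ?; apply: is_derive_eq.
by rewrite subr_ge0 dfg.
Qed.

(** The hypotheses say that the symmetric matrices with rows [(q, g), (g, h)]
    and [(C, A), (A, B)] are positive semidefinite, and so is the adjugate
    [(B, -A), (-A, C)] of the second.  The product of two such matrices has a
    nonnegative trace, which is the conclusion. *)
Lemma psd_trace (R : realFieldType) (q g h A B C : R) :
  (forall t, 2 * t * g - t ^+ 2 * h <= q) ->
  (forall t, 2 * t * A - t ^+ 2 * B <= C) -> 2 * g * A <= q * B + h * C.
Proof.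
have psd_diag (u v z : R) : (forall t, 2 * t * u - t ^+ 2 * v <= z) -> 0 <= v.
  move=> H; rewrite leNgt; apply/negP => v0.
  have z0 : 0 <= z by have := H 0; lra.
  (* This [s] is large enough for both bounds at [s] and [- s] to fail: their
     sum would give [- s ^+ 2 * v <= z], while [s * v = v - z]. *)
  pose s := 1 - z / v.
  have sv : s * v = v - z by rewrite /s; field; exact: ltr0_neq0.
  have s1 : 1 <= s.
    have : z / v <= 0 by rewrite mulr_ge0_le0// invr_le0 ltW.
    by rewrite /s; lra.
  have := H s; have := H (- s); nra.
move=> H1 H2.
have [h0 B0] := (psd_diag _ _ _ H1, psd_diag _ _ _ H2).
have C0 : 0 <= C by have := H2 0; lra.
have [Bp|Bn|BE] := ltgtP B 0; first by nra.
  (* [t = A / B] is where the second hypothesis is sharpest. *)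
  have e1 : (A / B) * B = A by field; exact: lt0r_neq0.
  have := H1 (A / B); have := H2 (A / B); set t := A / B in e1 *.
  move=> {}H2 {}H1; rewrite -e1 in H2 *.
  have := mulr_ge0 h0 (_ : 0 <= C - t ^+ 2 * B).
  have -> : 0 <= C - t ^+ 2 * B by nra.
  move=> /(_ isT); nra.
have A0 : A = 0.
  apply/eqP/negPn/negP => A0.
  (* With [B = 0] the bound is linear in [t], and this [t] violates it. *)
  have := H2 ((C + 1) / (2 * A)).
  have -> : 2 * ((C + 1) / (2 * A)) * A = C + 1 by field.
  rewrite BE; lra.
by rewrite A0 BE; have := mulr_ge0 h0 C0; lra.
Qed.

(** The classical argument for a weight [w = exp (- V)] with [p = V'] and
    [h = V'' >= 0] writes the variance as an integral over pairs [x < y] and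
    uses [(g y - g x)^2 <= (int_x^y q) * (p y - p x)], which follows from the
    Cauchy-Schwarz inequality and [g'^2 <= q * h]; integrating [p * w = - w']
    then gives the bound.  Here the double and triple integrals are avoided:
    every integral is a function of its upper bound, and each inequality
    between two of them is obtained by comparing their derivatives.  The
    integrals enter only through the primitives [Z, S1, S2, C, Q0, Q1].

    The hypothesis [qP], required for all [t], combines [q >= 0], [h >= 0] and
    [g'^2 <= q * h] into a condition that is linear in [q], [g'] and [h]. *)
Section primitives.
Context {R : realType}.
Variables (a b : R) (w p h g dg q : R -> R).
Hypothesis ab : a <= b.
Hypothesis w_gt0 : forall x, 0 < w x.
Hypothesis dw : forall x : R, is_derive x 1 w (- (p x * w x)).
Hypothesis dp : forall x : R, is_derive x 1 p (h x).
Hypothesis dg_ : forall x : R, is_derive x 1 g (dg x).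
Hypothesis qP : forall x t, 2 * t * dg x - t ^+ 2 * h x <= q x.
Variables (Z S1 S2 C Q0 Q1 : R -> R).
Local Notation primitive F f :=
  (F a = 0 /\ forall x, a <= x <= b -> is_derive x (1 : R) F (f x)).
Hypothesis Zw : primitive Z w.
Hypothesis S1w : primitive S1 (fun x => g x * w x).
Hypothesis S2w : primitive S2 (fun x => g x ^+ 2 * w x).
Hypothesis Cw : primitive C (fun x => q x * Z x).
Hypothesis Q0w : primitive Q0 q.
Hypothesis Q1w : primitive Q1 (fun x => q x * w x).

Lemma poincare_primitives : Z b * S2 b - S1 b ^+ 2 <= Z b * Q1 b.
Proof.
have q0 x : 0 <= q x by have := qP x 0; lra.
have [[Za dZ] [S1a dS1] [S2a dS2]] := (And3 Zw S1w S2w).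
have [[Ca dC] [Q0a dQ0] [Q1a dQ1]] := (And3 Cw Q0w Q1w).
have aa : a <= a <= b by rewrite lexx.
have Z0 x : a <= x <= b -> 0 <= Z x.
  by move=> abx; rewrite -Za; apply: ge0_derive_le abx => // y _; exact: ltW.
have C0 x : a <= x <= b -> 0 <= C x.
  move=> abx; rewrite -Ca; apply: ge0_derive_le abx => // y aby.
  by rewrite mulr_ge0// Z0.
(* At the point [x], [A] and [B] are the integrals of [(g x - g y) * w y] and
   [(p x - p y) * w y] over [a <= y <= x]. *)
pose A : R -> R := g * Z - S1.
pose B : R -> R := Z * p + w - cst (w a).
pose D : R -> R := Q1 - cst (w a) * Q0.
have dA x : a <= x <= b -> is_derive x 1 A (dg x * Z x).
  move=> abx; have := dZ x abx; have := dS1 x abx => ? ?.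
  by apply: is_derive_eq; rewrite /GRing.scale/=; ring.
have dB x : a <= x <= b -> is_derive x 1 B (h x * Z x).
  move=> abx; have := dZ x abx => ?.
  by apply: is_derive_eq; rewrite /GRing.scale/=; ring.
have dD x : a <= x <= b -> is_derive x 1 D (q x * (w x - w a)).
  move=> abx; have := dQ1 x abx; have := dQ0 x abx => ? ?.
  apply: is_derive_eq; rewrite /GRing.scale/=; ring.
have ABC x t : a <= x <= b -> 2 * t * A x - t ^+ 2 * B x <= C x.
  apply: (@le_derive_le _ (cst (2 * t) * A - cst (t ^+ 2) * B) C
    (fun x => (2 * t * dg x - t ^+ 2 * h x) * Z x) _ a b _ _ dC) => [||y aby].
  - by rewrite /A /B !fctE Za S1a Ca; ring.
  - move=> y aby; have := dA y aby; have := dB y aby => ? ?.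
    by apply: is_derive_eq; rewrite /GRing.scale/=; ring.
  - by rewrite ler_wpM2r ?Z0.
(* [M] is the integral of [(g x - g y)^2 * w y] over [a <= y <= x], and [N] that
   of its upper bound [(int_y^x q) * (p x - p y) * w y]. *)
pose M : R -> R := g * g * Z - cst 2 * g * S1 + S2.
pose N : R -> R := p * C + D.
have dM x : a <= x <= b -> is_derive x 1 M (2 * dg x * A x).
  move=> abx; have := dZ x abx; have := dS1 x abx; have := dS2 x abx => ? ? ?.
  apply: is_derive_eq.
  by rewrite /GRing.scale /= /A !fctE; ring.
have dN x : a <= x <= b -> is_derive x 1 N (q x * B x + h x * C x).
  move=> abx; have := dC x abx; have := dD x abx; rewrite /N.
  generalize D => E ? ?; apply: is_derive_eq.
  by rewrite /GRing.scale /= /B !fctE; ring.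
have MN x : a <= x <= b -> M x <= N x.
  apply: (le_derive_le _ dM dN) => [|y aby].
    by rewrite /N /M /D !fctE Za S1a S2a Ca Q1a Q0a; ring.
  by apply: psd_trace => t; [exact: qP|exact: ABC].
(* [L] and [K] are the integrals of [w * M] and [w * N] from [a]; the first is
   the variance multiplied by [Z ^+ 2]. *)
pose L : R -> R := Z * S2 - S1 * S1.
pose K : R -> R := Z * D + (cst (w a) - w) * C.
have dL x : a <= x <= b -> is_derive x 1 L (w x * M x).
  move=> abx; have := dZ x abx; have := dS1 x abx; have := dS2 x abx => ? ? ?.
  apply: is_derive_eq.
  by rewrite /GRing.scale /= /M !fctE; ring.
have dK x : a <= x <= b -> is_derive x 1 K (w x * N x).
  move=> abx; have := dZ x abx; have := dC x abx; have := dD x abx; rewrite /K /N.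
  generalize D => E ? ? ?; apply: is_derive_eq.
  by rewrite /GRing.scale /= !fctE; ring.
have bb : a <= b <= b by rewrite ab lexx.
have LK : L b <= K b.
  apply: (le_derive_le _ dL dK _ bb) => [|y aby].
    by rewrite /K /L /D !fctE Za S1a S2a Ca Q1a Q0a; ring.
  by rewrite ler_wpM2l ?(ltW (w_gt0 _))// MN.
(* What separates [K] from [Z * Q1] are the boundary terms produced by the
   integration of [w'] over [a, b]; they have the right sign. *)
have CZQ : C b <= Z b * Q0 b.
  apply: (@le_derive_le _ C (Z * Q0) _ (fun x => w x * Q0 x + q x * Z x)
    a b _ dC _ _ b bb) => [|y aby|y aby].
  - by rewrite !fctE Za Ca mul0r.
  - have := dZ y aby; have := dQ0 y aby => ? ?.
    by apply: is_derive_eq; rewrite /GRing.scale/=; ring.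
  - rewrite lerDr mulr_ge0 ?(ltW (w_gt0 _))// -Q0a.
    exact: (ge0_derive_le dQ0).
have := C0 b bb; move: LK CZQ; rewrite /L /K /D !fctE => LK CZQ Cb.
have := mulr_ge0 (ltW (w_gt0 a)) (_ : 0 <= Z b * Q0 b - C b).
rewrite subr_ge0 => /(_ CZQ).
have := mulr_ge0 (ltW (w_gt0 b)) Cb.
move: LK; rewrite -[S1 b ^+ 2]/(S1 b * S1 b).
lra.
Qed.

End primitives.

(** Starting the integral at [a - 1] makes the primitive two-sided
    differentiable at [a] as well. *)
Lemma continuous_primitive (R : realType) (f : R -> R) (a b : R) : a <= b ->
  continuous f ->
  exists F : R -> R,
    (F a = 0 /\ forall x, a <= x <= b -> is_derive x (1 : R) F (f x)) /\
    \int[@lebesgue_measure R]_(x in `[a, b]) f x = F b.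
Proof.
move=> ab cf.
have fi u v : (@lebesgue_measure R).-integrable `[u, v] (EFin \o f).
  apply: continuous_compact_integrable; first exact: segment_compact.
  exact: continuous_subspaceT.
pose G (x : R) := \int[@lebesgue_measure R]_(t in `[(a - 1), x]) f t.
exists (G - cst (G a)); split; first split; first by rewrite !fctE subrr.
  move=> x /andP[ax xb].
  have xb1 : x < b + 1 by rewrite (le_lt_trans xb)// ltrDl.
  have a1x : a - 1 < x by rewrite (lt_le_trans _ ax)// ltrBlDr ltrDl.
  have [dG DG] := @continuous_FTC1_closed R f (a - 1) x _ xb1 (fi _ _) a1x (cf x).
  have GD : is_derive x (1 : R) G (f x).
    by apply: DeriveDef => //; rewrite -derive1E.
  by apply: is_derive_eq; rewrite subr0.
rewrite !fctE /G Rintegral_itvB ?bnd_simp//; last first.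
  by rewrite gerBl.
rewrite Rintegral_itv_obnd_cbnd//.
apply: integrableS (fi a b) => //=.
by apply: subset_itvr; rewrite bnd_simp.
Qed.

(** The inequality of the previous section with integrals in place of the
    primitives. *)
Section poincare.
Context {R : realType}.
Variables (a b : R) (w p h g dg q : R -> R).
Hypothesis ab : a <= b.
Hypothesis w_gt0 : forall x, 0 < w x.
Hypothesis dw : forall x : R, is_derive x 1 w (- (p x * w x)).
Hypothesis dp : forall x : R, is_derive x 1 p (h x).
Hypothesis dg_ : forall x : R, is_derive x 1 g (dg x).
Hypothesis cq : continuous q.
Hypothesis qP : forall x t, 2 * t * dg x - t ^+ 2 * h x <= q x.

Local Notation I f := (\int[@lebesgue_measure R]_(x in `[a, b]) f x).

Lemma poincare_1d :
  I w * I (fun x => g x ^+ 2 * w x) - I (fun x => g x * w x) ^+ 2 <=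
  I w * I (fun x => q x * w x).
Proof.
have cw : continuous w.
  by move=> x; apply/differentiable_continuous/derivable1_diffP; have [] := dw x.
have cg : continuous g.
  by move=> x; apply/differentiable_continuous/derivable1_diffP; have [] := dg_ x.
have [Z [Zw ->]] := continuous_primitive ab cw.
have cgw : continuous (fun x => g x * w x) by exact: continuous_mul.
have cg2w : continuous (fun x => g x ^+ 2 * w x).
  exact: (continuous_mul (continuous_mul cg cg)).
have cqw : continuous (fun x => q x * w x) by exact: continuous_mul.
have [S1 [S1w ->]] := continuous_primitive ab cgw.
have [S2 [S2w ->]] := continuous_primitive ab cg2w.
have [Q0 [Q0w _]] := continuous_primitive ab cq.
have [Q1 [Q1w ->]] := continuous_primitive ab cqw.
(* The primitive [Z] is only known to be continuous on [a, b]; composing it with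
   the projection onto that interval makes [q * Z] continuous everywhere. *)
pose clamp (x : R) := Num.max a (Num.min b x).
have clampP x : a <= clamp x <= b.
  by rewrite le_max lexx/= ge_max ab ge_min lexx.
have cqZ : continuous (fun x => q x * Z (clamp x)).
  apply: continuous_mul => // x; apply: continuous_comp.
    apply: continuous_max; first exact: cvg_cst.
    by apply: continuous_min; [exact: cvg_cst|exact: cvg_id].
  apply/differentiable_continuous/derivable1_diffP.
  by have [] := Zw.2 _ (clampP x).
have [C [[Ca dC] _]] := continuous_primitive ab cqZ.
apply: (poincare_primitives ab w_gt0 dw dp dg_ qP Zw S1w S2w _ Q0w Q1w (C := C)).
split => // x /[dup] abx /dC; rewrite /clamp.
by move: abx => /andP[ax xb]; rewrite (min_idPr xb) (max_idPr ax).
Qed.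

End poincare.

(** * Integration over cubes *)

(** The sigma-algebra generated by the coordinates contains the open sets
    because an open set is the union of the boxes with rational centres and
    radii [1 / (k + 1)] that it contains, a countable family. *)
Lemma open_measurable_rV (R : realType) n (U : set 'rV[R]_n) :
  open U -> measurable U.
Proof.
move=> oU.
pose B (p : 'rV[rat]_n * nat) : set 'rV[R]_n :=
  [set x | forall i, ball (ratr (p.1 ord0 i) : R) p.2.+1%:R^-1 (x ord0 i)].
have mB p : measurable (B p).
  apply: (@measurable_box_rV R n
    (fun i => ball (ratr (p.1 ord0 i) : R) p.2.+1%:R^-1)) => i.
  by rewrite ball_itv.
have -> : U = \bigcup_p (if `[< B p `<=` U >] then B p else set0).
  apply/seteqP; split => [x Ux|x [p _]]; last first.
    by case: ifPn => // /asboolP BU /BU.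
  have /nbhs_ballP[e /= e0 xeU] : nbhs x U by exact: open_nbhs_nbhs.
  pose k := Num.truncn (2 / e).
  have ke : k.+1%:R^-1 < e / 2.
    rewrite -[ltRHS]invf_div ltf_pV2 ?posrE ?divr_gt0 ?ltr0n//.
    exact: truncnS_gt.
  have k0 : (0 : R) < k.+1%:R^-1 by rewrite invr_gt0 ltr0n.
  have /choice[c cx] : forall i : 'I_n, exists q : rat,
      ball (x ord0 i) k.+1%:R^-1 (ratr q : R).
    move=> i.
    have : x ord0 i - k.+1%:R^-1 < x ord0 i + k.+1%:R^-1.
      by rewrite ltrBlDr -addrA ltrDl addr_gt0.
    by case/rat_in_itvoo => q qx; exists q; rewrite ball_itv.
  have Bx : B (\row_i c i, k) x.
    by move=> i; rewrite /= mxE; apply: ball_sym; exact: cx.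
  exists (\row_i c i, k) => //; case: ifPn => // /asboolP[]; move=> y By.
  apply: xeU; split => // i j; rewrite ord1.
  have := Bx j; have := By j; rewrite /= !mxE /ball/= => h1 h2.
  move: h1 h2 ke; rewrite !ltr_norml; move: k.+1%:R^-1 => d.
  by lra.
apply: countable_bigcupT_measurable => // p.
by case: ifPn => // _; exact: measurable0.
Qed.

Lemma continuous_measurable_rV (R : realType) n (f : 'rV[R]_n -> R) :
  continuous f -> measurable_fun [set: 'rV[R]_n] f.
Proof.
move=> /continuousP cf; apply: (measurability _ (RGenOpens.measurableE R)).
move=> _ [_ [a [b ->] <-]]; rewrite setTI; apply: open_measurable_rV.
exact/cf/interval_open.
Qed.

Definition cube (R : realType) n (M : R) : set 'rV[R]_n :=
  [set x | forall i, `[- M, M]%classic (x ord0 i)].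

Arguments cube {R} n M.

Lemma measurable_cube (R : realType) n (M : R) : measurable (cube n M).
Proof. by apply: (@measurable_box_rV R n (fun=> `[- M, M]%classic)) => i. Qed.

Lemma compact_cube (R : realType) n (M : R) : compact (cube n M).
Proof. by apply: (@rV_compact R n (fun=> `[- M, M]%classic)) => i; exact: segment_compact. Qed.

Lemma lebesgue_cube_fin (R : realType) n (M : R) :
  (lebesgue_rV R n (cube n M) < +oo)%E.
Proof.
rewrite (@lebesgue_rV_box R n (fun=> `[- M, M]%classic))//.
rewrite ltey_eq; apply/orP; left; elim/big_ind: _ => [//|x y|i _].
  exact: fin_numM.
by rewrite lebesgue_measure_itv/=; case: ifP.
Qed.

(** The cube of [R^(n+1)] fibers over its first coordinate.  The lemmas of this
    section give the regularity of the integrals along the fibers, which is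
    where working on a cube pays off: continuous functions are bounded there,
    and dominate themselves under the integral sign. *)
Section fiber.
Context {R : realType} {n : nat}.
Implicit Types (F : 'rV[R]_n.+1 -> R) (x : R) (y : 'rV[R]_n).

Lemma continuous_consrV_l y : continuous (fun x : R => consrV (x, y)).
Proof.
move=> x; apply/cvg_ballP => e e0.
apply: filterS (nbhsx_ballx x e e0) => z xz; split => // i j.
by rewrite !mxE; case: unliftP => [k _|_]; [exact: ballxx|exact: xz].
Qed.

Lemma continuous_consrV_r x : continuous (fun y => consrV (x, y)).
Proof.
move=> y; apply/(@cvg_ballP _ _ _ _ (nbhs_filter y)) => e e0.
apply: (@filterS _ (nbhs y) (nbhs_filter y) (ball y e)) (nbhsx_ballx y e e0) => z [_ yz]; split => // i j.
by rewrite !mxE; case: unliftP => [k _|_]; [exact: yz|exact: ballxx].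
Qed.

Lemma continuous_fiber_r F x : continuous F ->
  continuous (fun y => F (consrV (x, y))).
Proof.
move=> cF y.
exact: (continuous_comp (@continuous_consrV_r x y) (cF (consrV (x, y)))).
Qed.

Lemma consrV_cube (M : R) x y : cube n.+1 M (consrV (x, y)) <->
  `[- M, M]%classic x /\ cube n M y.
Proof.
split => [H|[Hx Hy] i]; last by rewrite mxE; case: unliftP.
split; first by have := H ord0; rewrite mxE unlift_none.
by move=> i; have := H (lift ord0 i); rewrite mxE liftK.
Qed.

Lemma continuous_integrable_cube_measure m
    (mu : {measure set 'rV[R]_m -> \bar R}) (F : 'rV[R]_m -> R) (M : R) :
  (mu (cube m M) < +oo)%E -> continuous F -> mu.-integrable (cube m M) (EFin \o F).
Proof.
move=> muM cF; apply: measurable_bounded_integrable => //.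
- exact: measurable_cube.
- by apply: measurable_funTS; exact: continuous_measurable_rV.
- have [C CP] := continuous_bounded_on (@compact_cube R m M) cF.
  by exists C; split; [exact: num_real|move=> D CD z /CP/le_trans; apply; exact: ltW].
Qed.

Lemma continuous_integrable_cube m (F : 'rV[R]_m -> R) (M : R) :
  continuous F -> (lebesgue_rV R m).-integrable (cube m M) (EFin \o F).
Proof. exact/continuous_integrable_cube_measure/lebesgue_cube_fin. Qed.

(** The integral over the last [n] coordinates, the first one being [x]. *)
Definition fiber_int (M : R) F x : R :=
  \int[lebesgue_rV R n]_(y in cube n M) F (consrV (x, y)).

(** This uniform bound for [z] near [x] is the domination under which
    [fiber_int] is continuous and differentiable in [x]. *)
Lemma fiber_bounded F (M : R) (x : R) : continuous F ->
  exists C : R, forall z y, `]x - 1, x + 1[%classic z -> cube n M y ->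
    `|F (consrV (z, y))| <= C.
Proof.
move=> cF; pose N := Num.max M (`|x| + 1).
have [C CP] := continuous_bounded_on (@compact_cube R n.+1 N) cF.
exists C => z y /=; rewrite in_itv/= => /andP[xz zx] My; apply: CP.
have MN : M <= N by rewrite le_max lexx.
have xN : `|x| + 1 <= N by rewrite le_max lexx orbT.
apply/consrV_cube; split => [|i].
  rewrite /= in_itv/=; have := ler_norm x; have := ler_norm (- x).
  by rewrite normrN; move: xz zx xN; lra.
by have := My i; rewrite /= !in_itv/= => /andP[? ?]; apply/andP; split; lra.
Qed.

Lemma fiber_int_continuous F (M : R) : continuous F ->
  continuous (fiber_int M F).
Proof.
move=> cF x; have [C CP] := fiber_bounded M x cF.
have intF z : `]x - 1, x + 1[%classic z ->
    (lebesgue_rV R n).-integrable (cube n M) (EFin \o (fun y => F (consrV (z, y)))).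
  by move=> _; exact/continuous_integrable_cube/continuous_fiber_r.
have cFl : {ae lebesgue_rV R n, forall y, cube n M y ->
    {in `]x - 1, x + 1[%classic, continuous (fun z => F (consrV (z, y)))}}.
  apply: aeW => y _ z _.
  exact: (continuous_comp (@continuous_consrV_l y z) (cF (consrV (z, y)))).
have intC : (lebesgue_rV R n).-integrable (cube n M) (EFin \o cst C).
  by apply: (@continuous_integrable_cube _ (cst C)); exact: cst_continuous.
have CP' z : `]x - 1, x + 1[%classic z ->
    {ae lebesgue_rV R n, forall y, cube n M y -> `|F (consrV (z, y))| <= cst C y}.
  by move=> xz; apply: aeW => y; exact: CP.
have := @continuity_under_integral _ _ _ (lebesgue_rV R n) _ _
  (@measurable_cube R n M) _ _ intF cFl _ intC CP'.
by apply; rewrite inE/= in_itv/=; lra.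
Qed.

Lemma is_derive_fiber F (F0 : 'rV[R]_n.+1 -> R) x y :
  (forall z, is_derive z (delta_mx 0 0) F (F0 z)) ->
  is_derive x (1 : R) (fun z => F (consrV (z, y))) (F0 (consrV (x, y))).
Proof.
move=> dF; have [] := dF (consrV (x, y)).
have E h : h *: delta_mx 0 0 + consrV (x, y) = consrV (h *: 1 + x, y).
  apply/rowP => i; rewrite !mxE; case: unliftP => [k ->|->] /=.
    by rewrite mulr0 add0r.
  by [].
rewrite /derivable /derive; under eq_fun do rewrite /= E.
by split.
Qed.

Lemma is_derive_fiber_r F (Fi : 'rV[R]_n.+1 -> R) (i : 'I_n) x y :
  (forall z, is_derive z (delta_mx 0 (lift 0 i)) F (Fi z)) ->
  is_derive y (delta_mx 0 i) (fun y => F (consrV (x, y))) (Fi (consrV (x, y))).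
Proof.
move=> dF; have [] := dF (consrV (x, y)).
have E h : h *: delta_mx 0 (lift 0 i) + consrV (x, y) =
           consrV (x, h *: delta_mx 0 i + y).
  apply/rowP => k; rewrite !mxE; case: unliftP => [j ->|->] /=.
    by rewrite !mxE (inj_eq lift_inj).
  by rewrite mulr0 add0r.
rewrite /derivable /derive; under eq_fun do rewrite /= E.
by split.
Qed.

Lemma fiber_int_derive F (F0 : 'rV[R]_n.+1 -> R) (M x : R) : continuous F ->
  (forall z y, is_derive z (1 : R) (fun t => F (consrV (t, y)))
                 (F0 (consrV (z, y)))) -> continuous F0 ->
  is_derive x (1 : R) (fiber_int M F) (fiber_int M F0 x).
Proof.
move=> cF dF cF0; have [C CP] := fiber_bounded M x cF0.
have D1 z y : partial1of2 (fun x y => F (consrV (x, y))) z y = F0 (consrV (z, y)).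
  by rewrite partial1of2E; have [] := dF z y.
have Ix : `]x - 1, x + 1[%classic x by rewrite /= in_itv/=; lra.
have intF z : `]x - 1, x + 1[%classic z ->
    (lebesgue_rV R n).-integrable (cube n M) (EFin \o (fun y => F (consrV (z, y)))).
  by move=> _; exact/continuous_integrable_cube/continuous_fiber_r.
have dFz z y : `]x - 1, x + 1[%classic z -> cube n M y ->
    derivable (fun x => F (consrV (x, y))) z 1.
  by move=> _ _; have [] := dF z y.
have intC : (lebesgue_rV R n).-integrable (cube n M) (EFin \o cst `|C|).
  by apply: (@continuous_integrable_cube _ (cst `|C|)); exact: cst_continuous.
have CP' z y : `]x - 1, x + 1[%classic z -> cube n M y ->
    `|partial1of2 (fun x y => F (consrV (x, y))) z y| <= cst `|C| y.
  by move=> xz My; rewrite D1 (le_trans (CP _ _ xz My))// ler_norm.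
have dI := @derivable_under_integral _ _ _ (lebesgue_rV R n) _ _
  (@measurable_cube R n M) _ _ _ Ix intF dFz _ (fun=> normr_ge0 C) intC CP'.
have DI := @differentiation_under_integral _ _ _ (lebesgue_rV R n) _ _
  (@measurable_cube R n M) _ _ _ Ix intF dFz _ (fun=> normr_ge0 C) intC CP'.
apply: DeriveDef => //.
rewrite -derive1E; apply: etrans DI _; apply: eq_Rintegral => y _.
exact: D1.
Qed.

Lemma fubini_cube F (M : R) : continuous F ->
  \int[lebesgue_rV R n.+1]_(z in cube n.+1 M) F z =
  \int[@lebesgue_measure R]_(x in `[- M, M]) fiber_int M F x.
Proof.
move=> cF.
pose m := lebesgue_rV R n.
pose P : {measure set (measurableTypeR R * 'rV[R]_n)%type -> \bar R} :=
  (@lebesgue_measure R \x m)%E.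
have mc : measurable_fun [set: measurableTypeR R * 'rV[R]_n] (@consrV R n).
  exact: (@measurable_consrV _ R n).
pose G (p : measurableTypeR R * 'rV[R]_n) : R := F (consrV p).
pose S : set (measurableTypeR R * 'rV[R]_n) := @consrV R n @^-1` cube n.+1 M.
have mS : measurable S.
  by rewrite -[X in measurable X]setTI; apply: mc => //; exact: measurable_cube.
have mG : measurable_fun [set: measurableTypeR R * 'rV[R]_n] G.
  by apply: (measurableT_comp (continuous_measurable_rV cF) mc).
have iG : P.-integrable S (EFin \o G).
  apply: measurable_bounded_integrable => //.
  - exact: (@lebesgue_cube_fin R n.+1 M).
  - exact: measurable_funTS.
  - have [C CP] := continuous_bounded_on (@compact_cube R n.+1 M) cF.
    by exists C; split; [exact: num_real|move=> D CD z /CP/le_trans; apply; exact: ltW].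
have E1 : (\int[lebesgue_rV R n.+1]_(z in cube n.+1 M) (F z)%:E =
           \int[P]_(p in S) (G p)%:E)%E.
  have mF : measurable_fun [set: 'rV[R]_n.+1] (fun z => (F z)%:E).
    by apply/measurable_EFinP; exact: continuous_measurable_rV.
  have H := @integral_pushforward _ _ _ _ R _ mc P _ _ mF iG (@measurable_cube R n.+1 M).
  etransitivity; last exact: H.
  reflexivity.
rewrite /Rintegral; congr fine; rewrite E1 [LHS]integral_mkcond.
have iGS : P.-integrable setT ((EFin \o G) \_ S).
  by apply/(integrable_mkcond _ _).1.
rewrite -[LHS](@integral12_prod_meas1 _ _ _ _ R _ m _ iGS) [RHS]integral_mkcond.
apply: eq_integral => x _; rewrite /fubini_F patchE.
pose H (y : 'rV[R]_n) : \bar R :=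
  if x \in `[- M, M]%classic then (F (consrV (x, y)))%:E else 0%E.
transitivity (\int[m]_y (H \_ (cube n M)) y)%E.
  apply: eq_integral => y _; rewrite !patchE.
  have -> : ((x, y) \in S) = (x \in `[- M, M]%classic) && (y \in cube n M).
    by apply/idP/andP; rewrite !inE => /consrV_cube.
  by rewrite /H; case: (x \in _); case: (y \in _).
rewrite /H -integral_mkcond; case: ifPn => xM; last exact: integral0.
rewrite /fiber_int /Rintegral fineK//; apply: integrable_fin_num => //.
  exact: measurable_cube.
exact/continuous_integrable_cube/continuous_fiber_r.
Qed.

End fiber.

Lemma is_derive_weight (R : realType) (a b : R -> R) (x da db : R) :
  is_derive x (1 : R) a da -> is_derive x (1 : R) b db ->
  is_derive x (1 : R) (fun z => a z * expR (- b z)) ((da - a x * db) * expR (- b x)).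
Proof.
move=> dxa dxb.
have dE : is_derive x (1 : R) (expR \o (- b)) (expR (- b x) * - db).
  by apply: is_derive1_comp; exact: is_deriveN.
suff : is_derive x (1 : R) (a * (expR \o (- b))) ((da - a x * db) * expR (- b x)) by [].
by apply: is_derive_eq; rewrite /GRing.scale/=; ring.
Qed.

Lemma is_derive_quot (R : realType) (a b : R -> R) (x da db : R) : b x != 0 ->
  is_derive x (1 : R) a da -> is_derive x (1 : R) b db ->
  is_derive x (1 : R) (fun z => a z / b z) (da / b x - a x * db / b x ^+ 2).
Proof.
move=> b0 dxa dxb.
suff : is_derive x (1 : R) (a * (fun z => (b z)^-1)) (da / b x - a x * db / b x ^+ 2) by [].
by apply: (is_derive_eq (is_deriveM dxa (is_deriveV b0 dxb))); rewrite /GRing.scale/=; field.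
Qed.

Lemma lebesgue_cube_gt0 (R : realType) n (M : R) : 0 < M ->
  0 < fine (lebesgue_rV R n (cube n M)).
Proof.
move=> M0; rewrite (@lebesgue_rV_box R n (fun=> `[- M, M]%classic))//.
have E : @lebesgue_measure R `[- M, M] = (M + M)%:E.
  by rewrite lebesgue_measure_itv/= lte_fin ifT ?gtrN// opprK.
under eq_bigr do rewrite E.
by rewrite prodEFin/= prodr_gt0// => i _; rewrite addr_gt0.
Qed.

(** * The inequality on a cube *)

(** Integrals along the fibers with the weight [exp (- phi)]; they are not
    divided by the mass [E (cst 1)]. *)
Section weighted.
Context {R : realType} {n : nat}.
Variables (M : R) (phi : 'rV[R]_n.+1 -> R).
Hypothesis M0 : 0 < M.
Hypothesis cphi : continuous phi.
Implicit Types f g : 'rV[R]_n.+1 -> R.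

Definition wfiber_int f := fiber_int M (fun z => f z * expR (- phi z)).

Local Notation E := wfiber_int.

Lemma continuous_weight f : continuous f -> continuous (fun z => f z * expR (- phi z)).
Proof.
move=> cf; by apply: continuous_mul => //; exact/continuous_expRN.
Qed.

Lemma wfiber_int_continuous f : continuous f -> continuous (E f).
Proof. by move=> cf; exact/fiber_int_continuous/continuous_weight. Qed.

Lemma wfiber_int_lin f g (c : R) x : continuous f -> continuous g ->
  E (fun z => f z + c * g z) x = E f x + c * E g x.
Proof.
move=> cf cg; have mM := @measurable_cube R n M.
have iF (u : 'rV[R]_n.+1 -> R) : continuous u -> (lebesgue_rV R n).-integrable (cube n M)
    (EFin \o (fun y => u (consrV (x, y)) * expR (- phi (consrV (x, y))))).
  move=> cu; apply: continuous_integrable_cube.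
  exact: (@continuous_fiber_r _ _ _ x (continuous_weight cu)).
rewrite /wfiber_int /fiber_int -RintegralZl//; last exact: iF.
rewrite -RintegralD//; last 2 first.
- exact: iF.
- have := iF (fun z => c * g z) (continuous_scale cg).
  by under eq_fun do rewrite /= -mulrA; apply.
by apply: eq_Rintegral => y _; rewrite mulrDl mulrA.
Qed.

Lemma wfiber_int_lin2 f g k (b c : R) x :
  continuous f -> continuous g -> continuous k ->
  E (fun z => f z + b * g z + c * k z) x = E f x + b * E g x + c * E k x.
Proof.
move=> cf cg ck; rewrite -(wfiber_int_lin b x cf cg).
exact: (wfiber_int_lin c x (continuous_add cf (continuous_scale cg)) ck).
Qed.

Lemma wfiber_int_gt0 x : 0 < E (cst 1) x.
Proof.
have cx := continuous_fiber_r (x := x) cphi.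
have [C CP] := continuous_bounded_on (@compact_cube R n M) cx.
apply: (@lt_le_trans _ _ (expR (- C) * fine (lebesgue_rV R n (cube n M)))).
  by rewrite mulr_gt0 ?expR_gt0 ?lebesgue_cube_gt0.
have mM := @measurable_cube R n M.
rewrite -Rintegral_cst//; apply: le_Rintegral => // [||y My].
- by apply: (@continuous_integrable_cube _ _ (cst (expR (- C)))); exact: cst_continuous.
- apply: continuous_integrable_cube.
  apply: (@continuous_fiber_r _ _ (fun z => cst 1 z * expR (- phi z)) x).
  by apply: continuous_weight; exact: cst_continuous.
- by rewrite mul1r ler_expR lerN2 (le_trans (ler_norm _))// CP.
Qed.

(** Differentiating the weight produces the covariance-like term with
    [p0], the derivative of [phi] along the first coordinate. *)
Lemma wfiber_int_derive f (f0 p0 : 'rV[R]_n.+1 -> R) x :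
  continuous f -> continuous f0 -> continuous p0 ->
  (forall z, is_derive z (delta_mx 0 0) f (f0 z)) ->
  (forall z, is_derive z (delta_mx 0 0) phi (p0 z)) ->
  is_derive x (1 : R) (E f) (E f0 x - E (fun z => f z * p0 z) x).
Proof.
move=> cf cf0 cp0 df dphi.
have -> : E f0 x - E (fun z => f z * p0 z) x =
    E (fun z => f0 z + -1 * (f z * p0 z)) x.
  by rewrite wfiber_int_lin ?mulN1r//; exact: continuous_mul.
apply: fiber_int_derive => [|z y|].
- exact: continuous_weight.
- rewrite mulN1r; apply: is_derive_weight; exact: is_derive_fiber.
- apply/continuous_weight/continuous_add => //.
  exact/continuous_scale/continuous_mul.
Qed.

Lemma fubini_wcube f : continuous f ->
  \int[lebesgue_rV R n.+1]_(z in cube n.+1 M) (f z * expR (- phi z)) =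
  \int[@lebesgue_measure R]_(x in `[- M, M]) E f x.
Proof. by move=> cf; rewrite fubini_cube//; exact: continuous_weight. Qed.

End weighted.

Lemma big_ord_recl_unlift (R : realType) n (f : 'I_n.+1 -> R -> R) (t : R) (w : 'I_n -> R) :
  \sum_k f k (if unlift ord0 k is Some i then w i else t) =
  f ord0 t + \sum_i f (lift ord0 i) (w i).
Proof.
rewrite big_ord_recl unlift_none; congr (_ + _).
by apply: eq_bigr => i _; rewrite liftK.
Qed.

Definition wcube_int (R : realType) n (M : R) (phi f : 'rV[R]_n -> R) : R :=
  \int[lebesgue_rV R n]_(x in cube n M) (f x * expR (- phi x)).

(** The bound [q >= sup_w (2 w . dg - w . h w)] replaces [dg . h^-1 dg], so that
    [h] is never inverted.  This dual form is what makes the induction work: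
    splitting [w = (t, u)] shows that, on each fiber, [g - t * p 0] satisfies
    the hypotheses in dimension [n] with [q - 2 t * dg 0 + t^2 * h 0 0] in place
    of [q], for every real [t].  Expanding the variance of [g - t * p 0] in
    powers of [t], the induction hypothesis reads
    [2 t * G' - t^2 * V'' <= m - v], where [m] is the mean of [q] on the fiber,
    [v] the variance and [G] the mean of [g] there, and [V] the potential of the
    first marginal, minus the logarithm of the mass of the fiber.  This is
    exactly the hypothesis of the one-dimensional inequality for the marginal,
    and the decomposition of the variance into the integral of [v] and the
    variance of [G] concludes. *)
Lemma brascamp_lieb_cube (R : realType) (M : R) : 0 < M ->
  forall (n : nat) (phi g q : 'rV[R]_n -> R) (p dg : 'I_n -> 'rV[R]_n -> R)
    (h : 'I_n -> 'I_n -> 'rV[R]_n -> R),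
  continuous phi -> continuous g -> continuous q ->
  (forall i, continuous (p i)) -> (forall i, continuous (dg i)) ->
  (forall i j, continuous (h i j)) ->
  (forall i x, is_derive x (delta_mx 0 i) phi (p i x)) ->
  (forall i x, is_derive x (delta_mx 0 i) g (dg i x)) ->
  (forall i j x, is_derive x (delta_mx 0 i) (p j) (h i j x)) ->
  (forall i j x, h i j x = h j i x) ->
  (forall x (w : 'I_n -> R), 2 * (\sum_i w i * dg i x) -
     \sum_i \sum_j w i * w j * h i j x <= q x) ->
  wcube_int M phi (cst 1) * wcube_int M phi (fun x => g x ^+ 2)
    - wcube_int M phi g ^+ 2 <= wcube_int M phi (cst 1) * wcube_int M phi q.
Proof.
move=> M0; elim=> [|n IH] phi g q p dg h cphi cg cq cp cdg ch dphi dg_ dp hC qP.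
  have JE (f : 'rV[R]_0 -> R) : continuous f -> wcube_int M phi f = f 0 * expR (- phi 0).
    move=> cf; have cF : continuous (fun x : 'rV[R]_0 => f x * expR (- phi x)).
      by apply: continuous_mul => //; exact: continuous_expRN.
    rewrite /wcube_int /Rintegral /= integral_dirac//.
    - by rewrite diracE mem_set ?mul1e//= => -[].
    - exact: measurable_cube.
    - by apply/measurable_EFinP/measurable_funTS; exact: continuous_measurable_rV.
  rewrite !JE//; last 2 first.
  - exact: (continuous_mul cg cg).
  - exact: cst_continuous.
  have := qP 0 (fun=> 0); rewrite !big_ord0 mulr0 subr0 => q0.
  have e0 := expR_gt0 (- phi 0).
  have : 0 <= q 0 * (expR (- phi 0)) ^+ 2 by rewrite mulr_ge0// sqr_ge0.
  rewrite /=; lra.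
pose E := wfiber_int M phi.
have c1 : continuous (cst 1 : 'rV[R]_n.+1 -> R) by exact: cst_continuous.
pose p0 := p ord0; pose dg0 := dg ord0; pose h00 := h ord0 ord0.
have cp0 : continuous p0 := cp ord0.
have cdg0 : continuous dg0 := cdg ord0.
have ch00 : continuous h00 := ch ord0 ord0.
have cgp : continuous (fun z => g z * p0 z) := continuous_mul cg cp0.
have cpp : continuous (fun z => p0 z * p0 z) := continuous_mul cp0 cp0.
have cgg : continuous (fun z => g z ^+ 2) by exact: (continuous_mul cg cg).
have W0 x : 0 < E (cst 1) x by exact: wfiber_int_gt0.
have IHx x t : E (cst 1) x * (E (fun z => g z ^+ 2) x - 2 * t * E (fun z => g z * p0 z) x
    + t ^+ 2 * E (fun z => p0 z * p0 z) x) - (E g x - t * E p0 x) ^+ 2 <=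
    E (cst 1) x * (E q x - 2 * t * E dg0 x + t ^+ 2 * E h00 x).
  have cG : continuous (fun z => g z + - t * p0 z).
    exact/continuous_add/continuous_scale.
  have : E (cst 1) x * E (fun z => (g z + - t * p0 z) ^+ 2) x -
      E (fun z => g z + - t * p0 z) x ^+ 2 <=
      E (cst 1) x * E (fun z => q z + - (2 * t) * dg0 z + t ^+ 2 * h00 z) x.
    apply: (@IH (fun y => phi (consrV (x, y)))
      (fun y => g (consrV (x, y)) + - t * p0 (consrV (x, y)))
      (fun y => q (consrV (x, y)) + - (2 * t) * dg0 (consrV (x, y))
                + t ^+ 2 * h00 (consrV (x, y)))
      (fun i y => p (lift ord0 i) (consrV (x, y)))
      (fun i y => dg (lift ord0 i) (consrV (x, y))
                  + - t * h (lift ord0 i) ord0 (consrV (x, y)))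
      (fun i j y => h (lift ord0 i) (lift ord0 j) (consrV (x, y)))).
    - exact: continuous_fiber_r.
    - exact: (continuous_fiber_r (F := fun z => g z + - t * p0 z)).
    - apply: (continuous_fiber_r
        (F := fun z => q z + - (2 * t) * dg0 z + t ^+ 2 * h00 z)).
      by apply: continuous_add; [apply: continuous_add => //|]; exact: continuous_scale.
    - by move=> i; exact: continuous_fiber_r.
    - move=> i; apply: (continuous_fiber_r
        (F := fun z => dg (lift ord0 i) z + - t * h (lift ord0 i) ord0 z)).
      by apply: continuous_add => //; exact: continuous_scale.
    - by move=> i j; exact: continuous_fiber_r.
    - by move=> i y; apply: is_derive_fiber_r => z; exact: dphi.
    - move=> i y.
      have := is_derive_fiber_r x y (dg_ (lift ord0 i)).
      have := is_derive_fiber_r x y (dp (lift ord0 i) ord0) => d1 d2.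
      exact: (is_deriveD d2 (is_deriveZ (- t) d1)).
    - by move=> i j y; apply: is_derive_fiber_r => z; exact: dp.
    - by move=> i j y; exact: hC.
    - move=> y w.
      pose z := consrV (x, y).
      have := qP z (fun k => if unlift ord0 k is Some i then w i else t).
      (* Expand [qP] along the decomposition of the vector into [t] and [w]. *)
      pose u k := if unlift ord0 k is Some i then w i else t.
      rewrite (big_ord_recl_unlift (fun k a => a * dg k z)).
      rewrite (big_ord_recl_unlift (fun k a => \sum_j a * u j * h k j z)).
      rewrite (big_ord_recl_unlift (fun j a => t * a * h ord0 j z)).
      under [X in _ - (_ + X)]eq_bigr do
        rewrite (big_ord_recl_unlift (fun j a => w _ * a * h (lift ord0 _) j z)).
      rewrite big_split/=.
      have -> : \sum_i t * w i * h ord0 (lift ord0 i) z =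
          t * \sum_i w i * h (lift ord0 i) ord0 z.
        by rewrite mulr_sumr; apply: eq_bigr => i _; rewrite mulrA hC.
      have -> : \sum_i w i * t * h (lift ord0 i) ord0 z =
          t * \sum_i w i * h (lift ord0 i) ord0 z.
        by rewrite mulr_sumr; apply: eq_bigr => i _; rewrite mulrA (mulrC t).
      have -> : \sum_i w i * (dg (lift ord0 i) z + - t * h (lift ord0 i) ord0 z) =
          \sum_i w i * dg (lift ord0 i) z - t * \sum_i w i * h (lift ord0 i) ord0 z.
        rewrite mulr_sumr -sumrB; apply: eq_bigr => i _; ring.
      rewrite /dg0 /h00 -/z; lra.
  have -> : (fun z => (g z + - t * p0 z) ^+ 2) =
      (fun z => g z ^+ 2 + - (2 * t) * (g z * p0 z) + t ^+ 2 * (p0 z * p0 z)).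
    by apply/funext => z; ring.
  rewrite /E !wfiber_int_lin2// wfiber_int_lin//.
  rewrite -/E; lra.
have cE f : continuous f -> continuous (E f) by exact: wfiber_int_continuous.
have dE f f0 x : continuous f -> continuous f0 ->
    (forall z, is_derive z (delta_mx 0 0) f (f0 z)) ->
    is_derive x (1 : R) (E f) (E f0 x - E (fun z => f z * p0 z) x).
  by move=> cf cf0 df; apply: wfiber_int_derive => //; exact: dphi.
have dW x : is_derive x (1 : R) (E (cst 1)) (- E p0 x).
  have := dE (cst 1) (cst 0) x c1 (@cst_continuous _ _ _).
  have -> : (fun z => cst 1 z * p0 z) = p0 by apply/funext => z; rewrite mul1r.
  have -> : E (cst 0) x = 0.
    rewrite /E /wfiber_int /fiber_int; under eq_Rintegral do rewrite mul0r.
    by rewrite /Rintegral integral0.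
  by rewrite sub0r; apply => z; exact: is_derive_cst.
(* The arguments are the marginal weight, the derivatives [V'] and [V''] of its
   potential, the conditional mean [G], its derivative, and [m - v]. *)
have := @poincare_1d R (- M) M (E (cst 1)) (fun x => E p0 x / E (cst 1) x)
  (fun x => (E h00 x - E (fun z => p0 z * p0 z) x) / E (cst 1) x
            - E p0 x * (- E p0 x) / E (cst 1) x ^+ 2)
  (fun x => E g x / E (cst 1) x)
  (fun x => (E dg0 x - E (fun z => g z * p0 z) x) / E (cst 1) x
            - E g x * (- E p0 x) / E (cst 1) x ^+ 2)
  (fun x => E q x / E (cst 1) x - E (fun z => g z ^+ 2) x / E (cst 1) x +
            (E g x / E (cst 1) x) ^+ 2).
have W0' x : E (cst 1) x != 0 by exact: lt0r_neq0.
have MM : - M <= M by lra.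
move=> /(_ MM W0).
have H1 x : is_derive x (1 : R) (E (cst 1)) (- (E p0 x / E (cst 1) x * E (cst 1) x)).
  by rewrite divfK.
have H2 x : is_derive x (1 : R) (fun x => E p0 x / E (cst 1) x)
    ((E h00 x - E (fun z => p0 z * p0 z) x) / E (cst 1) x
     - E p0 x * (- E p0 x) / E (cst 1) x ^+ 2).
  by apply: is_derive_quot => //; apply: dE => // z; exact: dp.
have H3 x : is_derive x (1 : R) (fun x => E g x / E (cst 1) x)
    ((E dg0 x - E (fun z => g z * p0 z) x) / E (cst 1) x
     - E g x * (- E p0 x) / E (cst 1) x ^+ 2).
  by apply: is_derive_quot => //; apply: dE => // z; exact: dg_.
have cV : continuous (fun x => (E (cst 1) x)^-1).
  by move=> x; apply: cvgV => //; exact: cE.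
have cGW : continuous (fun x => (E g x / E (cst 1) x) ^+ 2).
  by have cG := continuous_mul (cE _ cg) cV; exact: (continuous_mul cG cG).
have H4 : continuous (fun x =>
    E q x / E (cst 1) x - E (fun z => g z ^+ 2) x / E (cst 1) x
    + (E g x / E (cst 1) x) ^+ 2).
  apply: continuous_add => //; apply: continuous_sub.
    exact: (continuous_mul (cE _ cq) cV).
  exact: (continuous_mul (cE _ cgg) cV).
have H5 x t : 2 * t *
     ((E dg0 x - E (fun z => g z * p0 z) x) / E (cst 1) x
      - E g x * (- E p0 x) / E (cst 1) x ^+ 2) -
   t ^+ 2 * ((E h00 x - E (fun z => p0 z * p0 z) x) / E (cst 1) x
      - E p0 x * (- E p0 x) / E (cst 1) x ^+ 2) <=
   E q x / E (cst 1) x - E (fun z => g z ^+ 2) x / E (cst 1) x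
   + (E g x / E (cst 1) x) ^+ 2.
  rewrite -subr_ge0; have /= := IHx x t; rewrite -subr_ge0.
  move=> /(divr_ge0 (y := E (cst 1) x ^+ 2)) /(_ (sqr_ge0 _)).
  by congr (0 <= _); field.
move=> /(_ H1 H2 H3 H4 H5).
have iR f : continuous f -> (@lebesgue_measure R).-integrable `[- M, M] (EFin \o f).
  move=> cf; apply: continuous_compact_integrable; first exact: segment_compact.
  exact: continuous_subspaceT.
have -> : \int[@lebesgue_measure R]_(x in `[- M, M])
      (E g x / E (cst 1) x * E (cst 1) x) = wcube_int M phi g.
  by rewrite [RHS]fubini_wcube//; apply: eq_Rintegral => x _; rewrite divfK.
have -> : \int[@lebesgue_measure R]_(x in `[- M, M])
     ((E q x / E (cst 1) x - E (fun z => g z ^+ 2) x / E (cst 1) x +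
       (E g x / E (cst 1) x) ^+ 2) * E (cst 1) x) =
   wcube_int M phi q - wcube_int M phi (fun z => g z ^+ 2) +
   \int[@lebesgue_measure R]_(x in `[- M, M])
     ((E g x / E (cst 1) x) ^+ 2 * E (cst 1) x).
  rewrite [wcube_int M phi q]fubini_wcube//.
  rewrite [wcube_int M phi (fun z => g z ^+ 2)]fubini_wcube//.
  rewrite -/E -RintegralB//; [|exact/iR/cE|exact/iR/cE].
  rewrite -RintegralD//; last 2 first.
  - by apply: (iR (fun x => E q x - E (fun z => g z ^+ 2) x));
      apply: continuous_sub; exact: cE.
  - exact/iR/(continuous_mul cGW)/cE.
  by apply: eq_Rintegral => x _; field.
have <- : wcube_int M phi (cst 1) =
    \int[@lebesgue_measure R]_(x in `[- M, M]) E (cst 1) x by exact: fubini_wcube.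
by lra.
Qed.

(** * Second derivatives of convex functions *)

Lemma is_derive_line (R : realType) (V : normedModType R) (f df : V -> R)
    (x u : V) (s : R) :
  (forall z, is_derive z u f (df z)) ->
  is_derive s (1 : R) (fun s : R => f (x + s *: u)) (df (x + s *: u)).
Proof.
move=> fdf; have [] := fdf (x + s *: u).
have E h : h *: u + (x + s *: u) = x + (h *: 1 + s) *: u.
  by rewrite scalerDl addrCA /GRing.scale/= mulr1.
rewrite /derivable /derive; under eq_fun do rewrite /= E.
by split.
Qed.

(** The mean value theorem, once along [u] and once along [v]. *)
Lemma second_difference (R : realType) (V : normedModType R) (f D E : V -> R)
    (u v x : V) (h : R) : 0 < h ->
  (forall z, is_derive z u f (D z)) -> (forall z, is_derive z v D (E z)) ->
  exists2 y, `|x - y| <= h * (`|u| + `|v|) &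
  f (x + h *: u + h *: v) - f (x + h *: u) - f (x + h *: v) + f x = h ^+ 2 * E y.
Proof.
move=> h0 fD DE.
have MVT0 (k dk : R -> R) : (forall s, is_derive s (1 : R) k (dk s)) ->
    exists2 a, 0 <= a <= h & k h - k 0 = dk a * h.
  move=> kdk; have [|a] := @MVT_segment R k dk 0 h (ltW h0) (fun s _ => kdk s).
    by apply: derivable_within_continuous => s _; have [] := kdk s.
  by rewrite in_itv/= subr0 => ah e; exists a.
have [a /andP[a0 ah] ea] := MVT0
  (fun s => f (x + h *: v + s *: u) - f (x + s *: u))
  (fun s => D (x + h *: v + s *: u) - D (x + s *: u)) (fun s =>
  is_deriveB (is_derive_line (x + h *: v) s fD) (is_derive_line x s fD)).
have [b /andP[b0 bh] eb] := MVT0 (fun s => D (x + a *: u + s *: v))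
  (fun s => E (x + a *: u + s *: v)) (fun s => is_derive_line (x + a *: u) s DE).
exists (x + a *: u + b *: v).
  rewrite -addrA opprD addNKr normrN (le_trans (ler_normD _ _))// !normrZ.
  by rewrite mulrDr lerD// ler_wpM2r// ger0_norm.
move: ea eb; rewrite !scale0r !addr0 => ea eb.
rewrite (addrAC x (h *: v) (a *: u)) eb (addrAC x (h *: v) (h *: u)) in ea.
transitivity (E (x + a *: u + b *: v) * h * h); last by ring.
by rewrite -ea; ring.
Qed.

(** Both the symmetry of second derivatives and their nonnegativity for convex
    functions follow from this limit, because the second difference is
    symmetric in [u] and [v], and nonnegative for [u = v] and [f] convex. *)
Lemma second_difference_cvg (R : realType) (V : normedModType R) (f D E : V -> R)
    (u v x : V) :
  (forall z, is_derive z u f (D z)) -> (forall z, is_derive z v D (E z)) ->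
  {for x, continuous E} ->
  (f (x + h *: u + h *: v) - f (x + h *: u) - f (x + h *: v) + f x) / h ^+ 2
    @[h --> (0 : R)^'+] --> E x.
Proof.
move=> fD DE cE; apply/cvgrPdist_le => e e0.
have /nbhs_normP[d /= d0 dE] : \forall y \near x, `|E x - E y| <= e by move: cE => /cvgrPdist_le; exact.
near=> h.
have h0 : 0 < h by [].
have [y xy ->] := second_difference x h0 fD DE.
rewrite mulrC mulKf ?expf_neq0 ?gt_eqF//; apply: dE => /=.
apply: le_lt_trans xy _.
have c0 : 0 < `|u| + `|v| + 1 by rewrite ltr_wpDl// addr_ge0.
apply: (@le_lt_trans _ _ (h * (`|u| + `|v| + 1))).
  by rewrite ler_wpM2l ?(ltW h0)// lerDl.
rewrite -ltr_pdivlMr//.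
near: h; apply: nbhs_right_lt; exact: divr_gt0.
Unshelve. all: by end_near. Qed.

Lemma derive_symmetric (R : realType) (V : normedModType R)
    (f Du Dv Duv Dvu : V -> R) (u v x : V) :
  (forall z, is_derive z u f (Du z)) -> (forall z, is_derive z v f (Dv z)) ->
  (forall z, is_derive z v Du (Duv z)) -> (forall z, is_derive z u Dv (Dvu z)) ->
  {for x, continuous Duv} -> {for x, continuous Dvu} -> Duv x = Dvu x.
Proof.
move=> fu fv fuv fvu cuv cvu.
have h1 := second_difference_cvg fu fuv cuv.
have h2 := second_difference_cvg fv fvu cvu.
apply: (cvg_unique _ h1 _) => //.
apply: cvg_trans h2; apply: near_eq_cvg; near=> h.
by congr (_ / _); rewrite (addrAC x); ring.
Unshelve. all: by end_near. Qed.

Lemma convex_derive2_ge0 (R : realType) (V : normedModType R) (f D E : V -> R)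
    (w x : V) :
  (forall z y, f (2^-1 *: z + 2^-1 *: y) <= 2^-1 * f z + 2^-1 * f y) ->
  (forall z, is_derive z w f (D z)) -> (forall z, is_derive z w D (E z)) ->
  {for x, continuous E} -> 0 <= E x.
Proof.
move=> cvx fD DE cE; have H := second_difference_cvg fD DE cE.
rewrite -(cvg_lim _ H)//; apply: limr_ge; first by apply/cvg_ex; exists (E x).
near=> h; rewrite divr_ge0 ?sqr_ge0//.
have := cvx (x + h *: w + h *: w) x.
have -> : 2^-1 *: (x + h *: w + h *: w) + 2^-1 *: x = x + h *: w.
  have e2 : (2^-1 : R) + 2^-1 = 1 by field.
  rewrite !scalerDr -addrA [X in _ + X]addrC addrACA -!scalerDl.
  by rewrite e2 !scale1r.
lra.
Unshelve. all: by end_near. Qed.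

(** * Quadratic forms and inverse matrices *)

Section quadratic.
Context {R : realType} {n : nat}.
Implicit Types (A : 'M[R]_n) (v w x y : 'rV[R]_n).

Lemma dotpE x y : dotp x y = (x *m y^T) ord0 ord0.
Proof. by rewrite mxE; apply: eq_bigr => i _; rewrite mxE. Qed.

Lemma dotpC x y : dotp x y = dotp y x.
Proof. by apply: eq_bigr => i _; rewrite mulrC. Qed.

Lemma dotpBl x y w : dotp (x - y) w = dotp x w - dotp y w.
Proof. by rewrite !dotpE mulmxBl mxE [X in _ + X]mxE. Qed.

Lemma dotpDr x y w : dotp w (x + y) = dotp w x + dotp w y.
Proof. by rewrite !dotpE linearD/= mulmxDr mxE. Qed.

Lemma dotpBr x y w : dotp w (x - y) = dotp w x - dotp w y.
Proof. by rewrite dotpC dotpBl !(dotpC w). Qed.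

Lemma dotpZr (c : R) x y : dotp x (c *: y) = c * dotp x y.
Proof. by rewrite !dotpE linearZ/= -scalemxAr mxE. Qed.

Lemma dotp_ge0 x : 0 <= dotp x x.
Proof. by apply: sumr_ge0 => i _; rewrite -expr2 sqr_ge0. Qed.

Lemma dotp_gt0 x : x != 0 -> 0 < dotp x x.
Proof.
move=> x0; rewrite lt_neqAle dotp_ge0 andbT eq_sym.
apply: contra x0 => /eqP x0; apply/eqP/rowP => i; rewrite mxE.
have /(_ i isT)/eqP : forall i, true -> x ord0 i * x ord0 i = 0.
  by apply: psumr_eq0P x0 => k _; rewrite -expr2 sqr_ge0.
by rewrite mulf_eq0 orbb => /eqP.
Qed.

Lemma dotp_mulmx_sym A x y : A^T = A -> dotp x (y *m A) = dotp (x *m A) y.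
Proof. by move=> AT; rewrite !dotpE trmx_mul AT mulmxA. Qed.

(** Half of the duality between the form of [A] and that of its inverse:
    expand the value of the form of [A] at [w - A^-1 v], which is nonnegative. *)
Lemma quad_le_inv A v w : A^T = A -> (forall u, 0 <= dotp u (u *m A)) ->
  A \in unitmx ->
  2 * dotp w v - dotp w (w *m A) <= dotp v (v *m invmx A).
Proof.
move=> AT A0 Au; pose u := v *m invmx A.
have uA : u *m A = v by rewrite mulmxKV.
have := A0 (w - u); rewrite mulmxBl uA dotpBl !dotpBr (dotp_mulmx_sym u w AT) uA.
by rewrite (dotpC u v) (dotpC v w) -/u; lra.
Qed.

Lemma posdef_unit A : (forall u, u != 0 -> 0 < dotp u (u *m A)) -> A \in unitmx.
Proof.
move=> A0; rewrite unitmxE unitfE; apply/negP => /det0P[u u0 uA].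
by have := A0 u u0; rewrite uA dotpE linear0 mulmx0 mxE ltxx.
Qed.

(** By duality the left-hand side is the supremum over [u] of
    [2 u . v - u . (A + e) u], and [A] gives larger values than [A + e]. *)
Lemma quad_inv_shift A v (e : R) : 0 <= e -> A^T = A ->
  (forall u, 0 <= dotp u (u *m A)) -> A \in unitmx -> A + e%:M \in unitmx ->
  dotp v (v *m invmx (A + e%:M)) <= dotp v (v *m invmx A).
Proof.
move=> e0 AT A0 Au Aeu; pose u := v *m invmx (A + e%:M).
have uA : u *m (A + e%:M) = v by rewrite mulmxKV.
have := quad_le_inv v u AT A0 Au.
have : dotp u (u *m (A + e%:M)) = dotp u (u *m A) + e * dotp u u.
  by rewrite mulmxDr mul_mx_scalar dotpDr dotpZr.
have := mulr_ge0 e0 (dotp_ge0 u).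
by rewrite uA -/u (dotpC v u); lra.
Qed.

End quadratic.

Lemma continuous_det (R : realType) (T : topologicalType) n (A : T -> 'M[R]_n) :
  (forall i j, continuous (fun x => A x i j)) -> continuous (fun x => \det (A x)).
Proof.
move=> cA; apply: continuous_sumr => s; apply: continuous_scale.
by apply: continuous_prodr => i; exact: cA.
Qed.

Lemma continuous_invmx (R : realType) (T : topologicalType) n (A : T -> 'M[R]_n) i j :
  (forall i j, continuous (fun x => A x i j)) -> (forall x, A x \in unitmx) ->
  continuous (fun x => invmx (A x) i j).
Proof.
move=> cA Au.
have -> : (fun x => invmx (A x) i j) = (fun x => (\det (A x))^-1 * cofactor (A x) j i).
  by apply/funext => x; rewrite /invmx Au !mxE.
apply: continuous_mul.
  move=> x; apply: cvgV; last exact: continuous_det.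
  by have := Au x; rewrite unitmxE unitfE.
apply: continuous_scale; apply: continuous_det => k l.
by under eq_fun do rewrite !mxE; exact: cA.
Qed.

(** * The Hessian *)

Section hessian.
Context {R : realType} {n : nat}.
Implicit Types (f : 'rV[R]_n -> R) (x v w : 'rV[R]_n).

Lemma is_derive_coord x v (j : 'I_n) :
  is_derive x v (fun y : 'rV[R]_n => y ord0 j) (v ord0 j).
Proof.
have d : differentiable (fun y : 'rV[R]_n => y ord0 j) x by exact: differentiable_coord.
apply: DeriveDef; first exact: diff_derivable.
rewrite /derive; apply: cvg_lim => //.
apply: (@cvg_trans _ (cst (v ord0 j) @ (0 : R)^')); last exact: cvg_cst.
apply: near_eq_cvg; near=> h.
have h0 : h != 0 by near: h; exact: nbhs_dnbhs_neq.
by rewrite /= !mxE addrK /GRing.scale/= mulKf.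
Unshelve. all: by end_near. Qed.

Lemma is_derive_dotp x v : is_derive x v (fun y : 'rV[R]_n => dotp y y) (2 * dotp x v).
Proof.
have H (i : 'I_n) : is_derive x v (fun y : 'rV[R]_n => y ord0 i * y ord0 i)
    (2 * (x ord0 i * v ord0 i)).
  have d := is_derive_coord x v i.
  by apply: (is_derive_eq (is_deriveM d d)); rewrite /GRing.scale/=; ring.
have := is_derive_sum H; rewrite -mulr_sumr.
by rewrite (_ : \sum_(i < n) _ = fun y : 'rV[R]_n => dotp y y)//; apply/funext => y; rewrite fct_sumE.
Qed.

Lemma is_derive_partial f x i : differentiable f x ->
  is_derive x (delta_mx 0 i) f (partial i f x).
Proof. by move=> df; apply: DeriveDef => //; exact: diff_derivable. Qed.

Lemma is_derive_grad f x w : differentiable f x ->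
  is_derive x w f (\sum_i w ord0 i * partial i f x).
Proof.
move=> df; apply: DeriveDef; first exact: diff_derivable.
rewrite deriveE// [in LHS](row_sum_delta w) linear_sum; apply: eq_bigr => i _.
by rewrite linearZ/= /partial deriveE.
Qed.

Lemma C2_continuous f : C2 f ->
  [/\ continuous f, forall i, continuous (partial i f) &
      forall i j, continuous (fun x => hess f x i j)].
Proof.
move=> [df dpf]; split => [x|i x|i j].
- exact: differentiable_continuous.
- by apply: differentiable_continuous; exact: (dpf i).1.
- rewrite (_ : (fun x => _) = partial i (partial j f)); first exact: (dpf j).2.
  by apply/funext => x; rewrite mxE.
Qed.

Lemma hess_sym f x : C2 f -> (hess f x)^T = hess f x.
Proof.
move=> [df dpf]; apply/matrixP => i j; rewrite !mxE.
apply: (@derive_symmetric _ _ f (partial i f) (partial j f) _ _ (delta_mx 0 i) (delta_mx 0 j)).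
- by move=> z; exact: is_derive_partial.
- by move=> z; exact: is_derive_partial.
- by move=> z; apply: is_derive_partial; exact: (dpf i).1.
- by move=> z; apply: is_derive_partial; exact: (dpf j).1.
- exact: (dpf i).2.
- exact: (dpf j).2.
Qed.

Lemma hess_psd f x w : C2 f -> strictly_convex f -> 0 <= dotp w (w *m hess f x).
Proof.
move=> /[dup] fC2 [df dpf] fcvx.
have [_ _ ch] := C2_continuous fC2.
pose E x := \sum_i w ord0 i * \sum_j w ord0 j * partial j (partial i f) x.
have cE : continuous E.
  apply: continuous_sumr => i; apply: continuous_scale; apply: continuous_sumr => j.
  by apply: continuous_scale; exact: (dpf i).2.
have -> : dotp w (w *m hess f x) = E x.
  apply: eq_bigr => i _; rewrite mxE; congr (_ * _).
  by apply: eq_bigr => j _; rewrite mxE.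
apply: (@convex_derive2_ge0 _ _ f (fun x => \sum_i w ord0 i * partial i f x) E w).
- move=> z y; have [->|zy] := eqVneq z y.
    have e2 : (2^-1 : R) + 2^-1 = 1 by field.
    by rewrite -scalerDl -mulrDl e2 scale1r mul1r.
  have half : 0 < (2^-1 : R) < 1 by lra.
  have := fcvx z y 2^-1 zy half.
  rewrite (_ : 1 - 2^-1 = 2^-1 :> R); last by field.
  exact: ltW.
- by move=> z; exact: is_derive_grad.
- move=> z; pose D i := is_derive_grad w ((dpf i).1 z).
  have := is_derive_sum (fun i => is_deriveZ (w ord0 i) (D i)).
  by rewrite (_ : \sum_(i < n) _ = fun x => \sum_i w ord0 i * partial i f x)//;
    apply/funext => y; rewrite fct_sumE.
- exact: cE.
Qed.

End hessian.

(** * Regularization of the potential *)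

(** The Hessian of [phi] may be singular at some points.  Adding a multiple of
    the squared norm to [phi] shifts it by [e%:M] and makes it invertible, with
    a continuous inverse, while it decreases both the weight [exp (- phi)] and
    the quadratic form of the inverse. *)
Definition ridge (R : realType) n (phi : 'rV[R]_n -> R) (e : R) (x : 'rV[R]_n) : R :=
  phi x + e / 2 * dotp x x.

Lemma dotp_continuous (R : realType) n : continuous (fun x : 'rV[R]_n => dotp x x).
Proof.
by apply: continuous_sumr => i; apply: continuous_mul; exact: coord_continuous.
Qed.

Lemma ridge_continuous (R : realType) n (phi : 'rV[R]_n -> R) (e : R) :
  continuous phi -> continuous (ridge phi e).
Proof.
move=> cphi; apply: continuous_add => //; apply: continuous_scale.
exact: dotp_continuous.
Qed.

Section ridge.
Context {R : realType} {n : nat}.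
Variables (phi g : 'rV[R]_n -> R) (e M : R).
Hypotheses (phiC2 : C2 phi) (phi_convex : strictly_convex phi) (gC1 : C1 g).
Hypotheses (e0 : 0 < e) (M0 : 0 < M).

Definition ridge_quad (x : 'rV[R]_n) : R :=
  dotp (grad g x) (grad g x *m invmx (hess phi x + e%:M)).

Let A x := hess phi x + e%:M.

Let A_sym x : (A x)^T = A x.
Proof. by rewrite /A linearD/= tr_scalar_mx hess_sym. Qed.

Let A_psd x u : dotp u (u *m A x) = dotp u (u *m hess phi x) + e * dotp u u.
Proof. by rewrite mulmxDr mul_mx_scalar dotpDr dotpZr. Qed.

Let A_ge0 x u : 0 <= dotp u (u *m A x).
Proof. by rewrite A_psd addr_ge0 ?hess_psd// mulr_ge0 ?dotp_ge0// ltW. Qed.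

Let A_unit x : A x \in unitmx.
Proof.
apply: posdef_unit => u u0; rewrite A_psd ltr_wpDl ?hess_psd//.
by rewrite mulr_gt0// dotp_gt0.
Qed.

Let A_continuous i j : continuous (fun x => A x i j).
Proof.
have [_ _ ch] := C2_continuous phiC2.
under eq_fun do rewrite mxE [X in _ + X]mxE.
by apply: continuous_add => //; exact: cst_continuous.
Qed.

Lemma C1_continuous : continuous g.
Proof. by move=> x; apply: differentiable_continuous; exact: gC1.1. Qed.

Lemma ridge_quad_continuous : continuous ridge_quad.
Proof.
have cg i : continuous (fun x => grad g x ord0 i).
  by under eq_fun do rewrite mxE; exact: gC1.2.
apply: continuous_sumr => i; apply: continuous_mul => //.
under eq_fun do rewrite mxE.
by apply: continuous_sumr => j; apply: continuous_mul => //; exact: continuous_invmx.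
Qed.

Lemma ridge_quad_ge0 x : 0 <= ridge_quad x.
Proof.
have := quad_le_inv (grad g x) 0 (A_sym x) (A_ge0 x) (A_unit x).
by rewrite mul0mx !dotpE !mul0mx mxE mulr0 subr0 -!dotpE.
Qed.

Lemma ridge_quad_le x :
  ((ridge_quad x)%:E <= inv_quad (hess phi x) (grad g x))%E.
Proof.
rewrite /inv_quad; case: ifPn => [Hu|_]; last exact: leey.
rewrite lee_fin; apply: quad_inv_shift => //.
- exact: ltW.
- exact: hess_sym.
- by move=> u; exact: hess_psd.
- exact: A_unit.
Qed.

Lemma brascamp_lieb_ridge :
  wcube_int M (ridge phi e) (cst 1) * wcube_int M (ridge phi e) (fun x => g x ^+ 2)
    - wcube_int M (ridge phi e) g ^+ 2 <=
  wcube_int M (ridge phi e) (cst 1) * wcube_int M (ridge phi e) ridge_quad.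
Proof.
have [cphi cp ch] := C2_continuous phiC2.
have [dphi dp] := phiC2.
have cx i : continuous (fun x : 'rV[R]_n => x ord0 i) by exact: coord_continuous.
apply: (@brascamp_lieb_cube R M M0 n (ridge phi e) g ridge_quad
  (fun i x => partial i phi x + e * x ord0 i) (fun i => partial i g)
  (fun i j x => A x i j)).
- exact: ridge_continuous.
- exact: C1_continuous.
- exact: ridge_quad_continuous.
- by move=> i; apply: continuous_add => //; exact: continuous_scale.
- exact: gC1.2.
- exact: A_continuous.
- move=> i x.
  apply: (is_derive_eq (is_deriveD (is_derive_partial i (dphi x))
    (is_deriveZ (e / 2) (is_derive_dotp x (delta_mx 0 i))))).
  congr (_ + _); rewrite /dotp (bigD1 i)//= big1 ?addr0; last first.
    by move=> j ji; rewrite mxE (negbTE ji) andbF mulr0.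
  by rewrite mxE !eqxx /= mulr1 /GRing.scale/=; field.
- by move=> i x; apply: is_derive_partial; exact: gC1.1.
- move=> i j x.
  apply: (is_derive_eq (is_deriveD (is_derive_partial i ((dp j).1 x))
    (is_deriveZ e (is_derive_coord x (delta_mx 0 i) j)))).
  rewrite /A !mxE eqxx/= /GRing.scale/= eq_sym.
  by case: (i == j); rewrite ?mulr1 ?mulr0 ?mulr1n ?mulr0n.
- by move=> i j x; rewrite -[in LHS]A_sym mxE.
- move=> x w; pose u : 'rV[R]_n := \row_i w i.
  have := quad_le_inv (grad g x) u (A_sym x) (A_ge0 x) (A_unit x).
  congr (_ * _ - _ <= _).
    by apply: eq_bigr => i _; rewrite !mxE.
  rewrite exchange_big/=; apply: eq_bigr => i _; rewrite !mxE mulr_sumr.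
  by apply: eq_bigr => j _; rewrite !mxE; ring.
Qed.

End ridge.

(** * Integrals against the measure with density exp (- phi) *)

Lemma density_integral d (T : measurableType d) (R : realType)
    (lam : {sigma_finite_measure set T -> \bar R}) (mu : probability T R)
    (w : T -> R) (E : set T) (f : T -> \bar R) :
  measurable_fun [set: T] w ->
  (forall A, measurable A -> mu A = \int[lam]_(x in A) (w x)%:E)%E ->
  measurable E -> mu.-integrable E f ->
  (\int[mu]_(x in E) f x = \int[lam]_(x in E) (f x * (w x)%:E))%E.
Proof.
move=> mw muw mE fi.
have mu_lam : mu `<< lam.
  apply/null_content_dominatesP => A mA A0.
  rewrite muw// null_set_integral//.
  by apply/measurable_EFinP; exact: measurable_funTS.
have mW : measurable_fun E (EFin \o w).
  by apply/measurable_EFinP; exact: measurable_funTS.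
have RNi := @Radon_Nikodym_integrable _ _ _ (charge_of_finite_measure mu) _ mu_lam.
rewrite -(Radon_Nikodym_change_of_variables mu_lam mE fi).
apply: ae_eq_integral => //.
- apply: emeasurable_funM; first exact: measurable_int fi.
  by apply: measurable_funTS; exact: measurable_int RNi.
- by apply: emeasurable_funM => //; exact: measurable_int fi.
- apply: ae_eqe_mul2l; apply: integral_ae_eq => //.
    exact: integrableS RNi.
  by move=> A AE mA; rewrite -Radon_Nikodym_integral// -muw.
Qed.

(** The integral of a nonnegative function is a supremum over the simple
    functions below it, hence monotone whether or not the larger function is
    measurable.  It will be [inv_quad] of the Hessian, which is discontinuous
    where the Hessian is singular. *)
Lemma ge0_le_integralT d (T : measurableType d) (R : realType)
    (mu : {measure set T -> \bar R}) (f g : T -> \bar R) :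
  (forall x, 0 <= f x)%E -> (forall x, f x <= g x)%E ->
  (\int[mu]_x f x <= \int[mu]_x g x)%E.
Proof.
move=> f0 fg; have g0 x : (0 <= g x)%E by exact: le_trans (fg x).
rewrite !ge0_integralTE//; apply: ereal_sup_le => _ [h /= hf <-].
by exists h => //= x; exact: le_trans (fg x).
Qed.

Section limit.
Context {R : realType} {n : nat}.
Variables (phi : 'rV[R]_n -> R) (mu : probability 'rV[R]_n R).
Hypotheses (cphi : continuous phi).
Hypothesis mu_density : forall A : set 'rV[R]_n, measurable A ->
  (mu A = \int[lebesgue_rV R n]_(x in A) (expR (- phi x))%:E)%E.

(** Integrating against [mu] with this factor amounts to restricting to a cube
    and regularizing [phi] by the parameter [1 / (N + 1)]. *)
Definition cutoff (N : nat) (x : 'rV[R]_n) : R :=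
  (x \in cube n N.+1%:R)%:R * expR (- (N.+1%:R^-1 / 2 * dotp x x)).

Lemma cutoff_ge0 N x : 0 <= cutoff N x.
Proof. by rewrite mulr_ge0 ?expR_ge0// ler0n. Qed.

Lemma cutoff_le1 N x : cutoff N x <= 1.
Proof.
rewrite mulr_ile1 ?expR_ge0 ?ler0n//; first by rewrite lern1 leq_b1.
by rewrite -expR0 ler_expR oppr_le0 mulr_ge0 ?dotp_ge0// divr_ge0.
Qed.

Lemma cutoff_nd x : nondecreasing_seq (cutoff ^~ x).
Proof.
move=> N K NK; have NK1 : N.+1%:R <= K.+1%:R :> R by rewrite ler_nat.
rewrite ler_pM ?expR_ge0 ?ler0n//.
  rewrite ler_nat; case: (boolP (x \in _)) => // /set_mem xN.
  by rewrite mem_set// => i; have := xN i; rewrite /= !in_itv/=; lra.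
rewrite ler_expR lerN2 ler_wpM2r ?dotp_ge0// ler_pM2r//.
by rewrite lef_pV2// ?posrE ltr0n.
Qed.

Lemma cutoff_cvg x : cutoff N x @[N --> \oo] --> (1 : R).
Proof.
pose S := \sum_i `|x ord0 i|.
apply: (@cvg_trans _ ((fun N : nat => expR (- (harmonic N / 2 * dotp x x))) @ \oo)).
  apply: near_eq_cvg; near=> N.
  rewrite /cutoff mem_set ?mul1r// => i.
  have SN : S <= N.+1%:R.
    rewrite ltW// (lt_le_trans (truncnS_gt S))// ler_nat ltnS.
    by near: N; exact: nbhs_infty_ge.
  have xS : `|x ord0 i| <= S by rewrite /S (bigD1 i)//= lerDl sumr_ge0.
  by rewrite /= in_itv/= -ler_norml (le_trans xS).
pose k (t : R) := expR (- (t / 2 * dotp x x)).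
have ck : continuous k.
  apply: continuous_expRN; apply: continuous_mul; last exact: cst_continuous.
  by apply: continuous_mul; [move=> ?; exact: cvg_id|exact: cst_continuous].
have k0 : k 0 = 1 by rewrite /k !mul0r oppr0 expR0.
have H := cvg_comp _ k (@cvg_harmonic R) (ck 0).
by rewrite k0 in H.
Unshelve. all: by end_near. Qed.

Lemma cutoff_integral N (f : 'rV[R]_n -> R) : continuous f ->
  (\int[mu]_x (cutoff N x * f x)%:E =
   (wcube_int N.+1%:R (ridge phi N.+1%:R^-1) f)%:E)%E.
Proof.
move=> cf; pose E (x : 'rV[R]_n) := expR (- (N.+1%:R^-1 / 2 * dotp x x)).
have mw : measurable_fun [set: 'rV[R]_n] (fun x => expR (- phi x)).
  by apply: continuous_measurable_rV; exact: continuous_expRN.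
have cE : continuous (fun x => E x * f x).
  apply: continuous_mul => //; apply/continuous_expRN/continuous_scale.
  exact: dotp_continuous.
have mM := @measurable_cube R n N.+1%:R.
have muM : (mu (cube n N.+1%:R) < +oo)%E 
  by rewrite (le_lt_trans (probability_le1 mu mM))// ltry.
have -> : (\int[mu]_x (cutoff N x * f x)%:E =
    \int[mu]_(x in cube n N.+1%:R) (E x * f x)%:E)%E.
  rewrite [RHS]integral_mkcond; apply: eq_integral => x _; rewrite patchE /cutoff.
  by case: (x \in _); rewrite ?mul1r// !mul0r.
rewrite (density_integral mw mu_density mM); last first.
  exact: (continuous_integrable_cube_measure muM cE).
rewrite /wcube_int /Rintegral fineK; last first.
  apply: integrable_fin_num => //; apply: continuous_integrable_cube.
  by apply: continuous_mul => //; apply: continuous_expRN; exact: ridge_continuous.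
apply: eq_integral => x _; rewrite -EFinM; congr EFin.
by rewrite /ridge opprD expRD /E; ring.
Qed.
End limit.

(** * Exhaustion of the space *)

Section centered.
Context {R : realType} {n : nat}.
Variables (phi g : 'rV[R]_n -> R) (mu : probability 'rV[R]_n R).
Hypotheses (phiC2 : C2 phi) (phi_convex : strictly_convex phi) (gC1 : C1 g).
Hypothesis mu_density : forall A : set 'rV[R]_n, measurable A ->
  (mu A = \int[lebesgue_rV R n]_(x in A) (expR (- phi x))%:E)%E.
Hypothesis g_int : mu.-integrable setT (EFin \o g).
Hypothesis g_mean : (\int[mu]_x (g x)%:E = 0)%E.

Let cphi : continuous phi. Proof. by case: (C2_continuous phiC2). Qed.
Let cg : continuous g. Proof. exact: C1_continuous. Qed.

Let J (f : 'rV[R]_n -> R) (N : nat) : R :=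
  wcube_int N.+1%:R (ridge phi N.+1%:R^-1) f.

Let cutoff_measurable N (f : 'rV[R]_n -> R) : continuous f ->
  measurable_fun [set: 'rV[R]_n] (fun x => (cutoff N x * f x)%:E).
Proof.
move=> cf; apply/measurable_EFinP; apply: measurable_funM; last first.
  exact: continuous_measurable_rV.
apply: measurable_funM.
  apply: (@measurable_indic _ _ R); exact: measurable_cube.
apply: continuous_measurable_rV; apply/continuous_expRN/continuous_scale.
exact: dotp_continuous.
Qed.

Let cutoff_lim x (f : 'rV[R]_n -> R) :
  (cutoff N x * f x)%:E @[N --> \oo] --> (f x)%:E.
Proof.
apply: cvg_EFin; first exact: nearW.
by have := cvgM (cutoff_cvg x) (cvg_cst (f x)); rewrite mul1r; apply.
Qed.

Let J_dominated (f : 'rV[R]_n -> R) : continuous f ->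
  mu.-integrable setT (EFin \o f) ->
  (J f N)%:E @[N --> \oo] --> (\int[mu]_x (f x)%:E)%E.
Proof.
move=> cf fi; under eq_fun do rewrite /J -(cutoff_integral cphi mu_density)//.
apply: (@dominated_cvg _ _ _ mu setT measurableT
  (fun N x => (cutoff N x * f x)%:E) (EFin \o f) (fun x => `|f x|%:E)).
- by move=> N; exact: cutoff_measurable.
- by move=> x _; exact: cutoff_lim.
- by [].
- exact: integrable_norm fi.
- move=> N x _; rewrite /= lee_fin normrM ger0_norm ?cutoff_ge0//.
  by rewrite ler_piMl// cutoff_le1.
Qed.

Let J_monotone (f : 'rV[R]_n -> R) : continuous f -> (forall x, 0 <= f x) ->
  (J f N)%:E @[N --> \oo] --> (\int[mu]_x (f x)%:E)%E.
Proof.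
move=> cf f0; under eq_fun do rewrite /J -(cutoff_integral cphi mu_density)//.
have -> : (\int[mu]_x (f x)%:E =
    \int[mu]_x limn (fun N => (cutoff N x * f x)%:E))%E.
  by apply: eq_integral => x _; apply/esym/cvg_lim => //; exact: cutoff_lim.
apply: cvg_monotone_convergence => //.
- by move=> N; exact: cutoff_measurable.
- by move=> N x _; rewrite lee_fin mulr_ge0// cutoff_ge0.
- by move=> x _ N K NK; rewrite lee_fin ler_wpM2r// cutoff_nd.
Qed.

(** Apply the inequality for the regularized potential on the cube of half-side
    [N + 1] and let [N] tend to infinity.  The mass tends to [1] and the mean of
    [g] to [0] by dominated convergence, and the right-hand side stays below the
    asserted bound; the integral of [g ^+ 2], possibly infinite a priori, is reached by
    monotone convergence. *)
Lemma centered_brascamp_lieb :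
  (\int[mu]_x (g x ^+ 2)%:E <=
   \int[mu]_x inv_quad (hess phi x) (grad g x))%E.
Proof.
pose q N := ridge_quad phi g N.+1%:R^-1.
have e0 N : (0 : R) < N.+1%:R^-1 by rewrite invr_gt0.
have q0 N x : 0 <= q N x by exact: ridge_quad_ge0.
have qle N x : ((q N x)%:E <= inv_quad (hess phi x) (grad g x))%E.
  exact: ridge_quad_le.
set rhs := (leRHS); have rhs0 : (0 <= rhs)%E.
  apply: integral_ge0 => x _; apply: le_trans (qle 0 x).
  by rewrite lee_fin.
have cq N : continuous (q N) by exact: ridge_quad_continuous.
have Jq N : ((J (q N) N)%:E <= rhs)%E.
  rewrite /J -(cutoff_integral cphi mu_density)//; apply: ge0_le_integralT.
    by move=> x; rewrite lee_fin mulr_ge0// cutoff_ge0.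
  move=> x; apply: le_trans (qle N x).
  by rewrite lee_fin ler_piMl// cutoff_le1.
have [->|rhsoo] := eqVneq rhs +oo%E; first exact: leey.
have rhs_fin : rhs \is a fin_num by rewrite ge0_fin_numE// ltey.
rewrite -(fineK rhs_fin); set r := fine rhs.
have {}Jq N : J (q N) N <= r by rewrite -lee_fin /r (fineK rhs_fin).
have J1 : J (cst 1) N @[N --> \oo] --> (1 : R).
  have := J_dominated (@cst_continuous _ _ (1 : R)).
  move=> /(_ (finite_measure_integrable_cst mu 1 measurableT)).
  have -> : (\int[mu]_x (cst (1 : R) x)%:E = 1)%E.
    rewrite -[LHS]/(\int[mu]_x cst 1%E x)%E (integral_cst mu measurableT).
    by rewrite mul1e; exact: probability_setT.
  by move=> /fine_cvg.
have Jg : J g N @[N --> \oo] --> (0 : R).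
  by have := J_dominated cg g_int; rewrite g_mean => /fine_cvg.
have cg2 : continuous (fun x => g x ^+ 2) by exact: (continuous_mul cg cg).
have Jg2 := J_monotone cg2 (fun x => sqr_ge0 (g x)).
have bnd : (r + J g N ^+ 2 / J (cst 1) N)%:E @[N --> \oo] --> r%:E.
  apply: cvg_EFin; first exact: nearW.
  have := cvgD (cvg_cst r) (cvgM (cvgM Jg Jg) (cvgV (oner_neq0 R) J1)).
  by rewrite !mul0r addr0; apply.
apply: (lee_cvg_to Jg2 bnd).
near=> N; rewrite lee_fin.
have J1N : 0 < J (cst 1) N.
  by near: N; apply: (cvgr_gt 1).
have := brascamp_lieb_ridge phiC2 phi_convex gC1 (e0 N) (ltr0Sn R N).
rewrite -/(J _ N) -/(J _ N) -/(J _ N) -/(q N) -/(J _ N) => BL.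
rewrite -lerBlDl ler_pdivlMr//.
have := ler_wpM2l (ltW J1N) (Jq N); lra.
Unshelve. all: by end_near. Qed.

End centered.

Lemma C1_sub_cst (R : realType) n (g : 'rV[R]_n -> R) (c : R) : C1 g ->
  C1 (fun x => g x - c) /\ forall x, grad (fun x => g x - c) x = grad g x.
Proof.
move=> [dg cdg]; have dgc x : differentiable (fun x => g x - c) x.
  exact: (differentiableB (dg x) (differentiable_cst c x)).
have pE i : partial i (fun x => g x - c) = partial i g.
  apply/funext => x; rewrite /partial.
  have := is_deriveB (is_derive_partial i (dg x)) (is_derive_cst c x (delta_mx 0 i)).
  by case=> _; rewrite subr0.
split; first by split=> // i; rewrite pE.
by move=> x; apply/rowP => i; rewrite !mxE pE.
Qed.

Theorem corollary2p6 (R : realType) (n : nat) (phi : 'rV[R]_n -> R)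
    (phiC2 : C2 phi)
    (phi_convex : strictly_convex phi)
    (phi_growth : phi x / enorm x @[x --> enorm_pinfty] --> +oo)
    (phi_int : (\int[lebesgue_rV R n]_x (expR (- phi x))%:E = 1)%E)
    (mu : probability 'rV[R]_n R)
    (mu_density : forall A : set 'rV[R]_n, measurable A ->
      (mu A = \int[lebesgue_rV R n]_(x in A) (expR (- phi x))%:E)%E)
    (g : 'rV[R]_n -> R)
    (gC1 : C1 g)
    (g_int : mu.-integrable setT (EFin \o g)) :
  ('V_mu[g] <= \int[mu]_x inv_quad (hess phi x) (grad g x))%E.
Proof.
pose m := fine (\int[mu]_x (g x)%:E)%E.
have mE : (\int[mu]_x (g x)%:E = m%:E)%E.
  by rewrite fineK//; exact: integrable_fin_num.
have [hC1 hgrad] := C1_sub_cst m gC1.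
have ic := finite_measure_integrable_cst mu m measurableT.
have h_int : mu.-integrable setT (EFin \o (fun x => g x - m)).
  exact: (integrableB measurableT g_int ic).
have h_mean : (\int[mu]_x (g x - m)%:E = 0)%E.
  under eq_integral do rewrite EFinB.
  rewrite (integralB measurableT g_int ic) mE.
  have -> : (\int[mu]_x (EFin \o cst m) x = m%:E)%E.
    apply: etrans (integral_cst mu measurableT m%:E) _.
    by rewrite -[RHS]mule1; congr (_ * _)%E; exact: probability_setT.
  by rewrite subee.
have -> : ('V_mu[g] = \int[mu]_x ((g x - m) ^+ 2)%:E)%E.
  by rewrite /variance unlock unlock.
have := centered_brascamp_lieb phiC2 phi_convex hC1 mu_density h_int h_mean.
by under [X in (_ <= X)%E -> _]eq_integral do rewrite hgrad.
Qed.
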